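(* If a 6-dimensional type $[33]$ $h$-space of nonconstant curvature, with metric $g_{ij}$ as described in the context, admits a nonhomothetic projective Lie algebra $P_r$ (of dimension $r$), then this algebra contains a subalgebra $H_{r-1}$ of infinitesimal homotheties of dimension $r-1$.
   Context: A comma denotes the covariant derivative with respect to the Levi-Civita connection of $g_{ij}$, and $L_\xi$ the Lie derivative. All objects are smooth and all statements are local (on a connected coordinate domain where $g_{ij}$ is nondegenerate). The 6-dimensional type $[33]$ $h$-space is the pseudo-Riemannian space (of signature $[++----]$) whose metric in coordinates $(x^1,\dots,x^6)$ is $$\begin{aligned} g_{ij}dx^idx^j={}& e_3 (f_6-f_3)^3 \Big\{ (dx^2)^2 +4A\,dx^1dx^3+2(\epsilon x^1-2 A \Sigma_1)dx^2 dx^3\\ &\quad+\big((\epsilon x^1)^2-4\epsilon x^1 A \Sigma_1+4A^2 \Sigma_2\big) (dx^3)^2 \Big\}\\ &+e_6 (f_3-f_6)^3\Big\{ (dx^5)^2+4 \tilde{A}\,dx^4dx^6+2(\tilde{\epsilon} x^4+2 \tilde{A} \Sigma_1)dx^5dx^6\\ &\quad+\big((\tilde{\epsilon} x^4)^2+4\tilde{\epsilon} x^4 \tilde{A} \Sigma_1+4\tilde{A}^2\Sigma_2\big) (dx^6)^2 \Big\},\end{aligned}$$ where $e_3,e_6=\pm1$; $\epsilon,\tilde\epsilon\in\{0,1\}$; $a$ is a constant, $a\neq0$ when $\tilde\epsilon=0$; $f_3=\epsilon x^3$, $f_6=\tilde\epsilon x^6+a$; $A=\epsilon x^2+\theta(x^3)$,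 $\tilde A=\tilde\epsilon x^5+\omega(x^6)$; $\Sigma_1=3(f_6-f_3)^{-1}$, $\Sigma_2=3(f_6-f_3)^{-2}$; $\theta(x^3),\omega(x^6)$ are arbitrary functions, with $\theta(x^3)\neq0$ when $\epsilon=0$ and $\omega(x^6)\neq0$ when $\tilde\epsilon=0$. The space is of constant curvature if $R^i_{jkl}=K(\delta^i_k g_{jl}-\delta^i_l g_{jk})$ for some constant $K$; otherwise it is of nonconstant curvature. A vector field $\xi^i$ is an infinitesimal projective transformation (projective motion) if there is a function $\phi$ such that $b_{ij}=L_\xi g_{ij}$ satisfies $b_{ij,k}=2g_{ij}\phi_{,k}+g_{ik}\phi_{,j}+g_{jk}\phi_{,i}$; it is an infinitesimal homothety if $L_\xi g_{ij}=k\,g_{ij}$ with $k$ constant. A nonhomothetic projective Lie algebra $P_r$ is an $r$-dimensional Lie algebra of infinitesimal projective transformations (under the Lie bracket of vector fields) that contains at least one element which is not an infinitesimal homothety. *)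

(* Defs.v *)
From HB Require Import structures.
From mathcomp Require Import all_boot all_order all_algebra.
From mathcomp Require Import all_classical all_reals all_analysis.

Set Implicit Arguments.
Unset Strict Implicit.
Unset Printing Implicit Defensive.

Import Order.TTheory GRing.Theory Num.Theory.
Import numFieldNormedType.Exports.

Local Open Scope classical_set_scope.
Local Open Scope ring_scope.

Section Smooth.
Variables (R : realType) (V W : normedModType R).

(* For open U in finite dimension this is C^k: a differentiable function with
   continuous directional derivatives is C^1, and so on by induction. *)
Fixpoint C_on (U : set V) (k : nat) (f : V -> W) : Prop :=
  match k with
  | 0 => forall x, U x -> {for x, continuous f}
  | k'.+1 => (forall x, U x -> differentiable f x) /\
             forall v : V, C_on U k' (fun x => 'D_v f x)
  end.

Definition smooth_on (U : set V) (f : V -> W) : Prop := forall k, C_on U k f.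

End Smooth.

(* Tensor fields are total functions on the coordinate space 'rV[R]_n; only
   their values on the coordinate domain U matter. *)
Section LocalGeometry.
Variables (R : realType) (n : nat).

Local Notation point := 'rV[R]_n.
Local Notation tensor2 := ('rV[R]_n -> 'M[R]_n).
Local Notation vfield := ('rV[R]_n -> 'rV[R]_n).

Definition partial (i : 'I_n) (f : point -> R) (x : point) : R :=
  'D_(delta_mx ord0 i) f x.

Definition has_signature (p q : nat) (G : 'M[R]_n) : Prop :=
  n = (p + q)%N /\
  exists2 P : 'M[R]_n, P \in unitmx &
    P^T *m G *m P = diag_mx (\row_i (if (i < p)%N then 1 else -1)).

Definition christoffel (g : tensor2) (i j k : 'I_n) (x : point) : R :=
  2^-1 * \sum_l invmx (g x) i l *
    (partial j (fun y => g y l k) x + partial k (fun y => g y l j) x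
     - partial l (fun y => g y j k) x).

(* [cov_deriv g b i j k] is b_{ij,k}. *)
Definition cov_deriv (g b : tensor2) (i j k : 'I_n) (x : point) : R :=
  partial k (fun y => b y i j) x
  - \sum_l christoffel g l k i x * b x l j
  - \sum_l christoffel g l k j x * b x i l.

(* [curvature g i j k l] is R^i_{jkl}. *)
Definition curvature (g : tensor2) (i j k l : 'I_n) (x : point) : R :=
  partial k (christoffel g i l j) x - partial l (christoffel g i k j) x
  + \sum_m christoffel g i k m x * christoffel g m l j x
  - \sum_m christoffel g i l m x * christoffel g m k j x.

Definition constant_curvature (U : set point) (g : tensor2) : Prop :=
  exists K : R, forall x, U x -> forall i j k l : 'I_n,
    curvature g i j k l x = K * ((i == k)%:R * g x j l - (i == l)%:R * g x j k).

Definition lie_deriv (xi : vfield) (g : tensor2) (x : point) : 'M[R]_n :=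
  \matrix_(i, j) \sum_l
    (xi x ord0 l * partial l (fun y => g y i j) x
     + g x l j * partial i (fun y => xi y ord0 l) x
     + g x i l * partial j (fun y => xi y ord0 l) x).

Definition lie_bracket (xi eta : vfield) (x : point) : 'rV[R]_n :=
  \row_i \sum_l
    (xi x ord0 l * partial l (fun y => eta y ord0 i) x
     - eta x ord0 l * partial l (fun y => xi y ord0 i) x).

Definition smooth_vfield (U : set point) (xi : vfield) : Prop :=
  forall i : 'I_n, smooth_on U (fun x => xi x ord0 i).

Definition projective_motion (U : set point) (g : tensor2) (xi : vfield) : Prop :=
  smooth_vfield U xi /\
  exists2 phi : point -> R, smooth_on U phi &
    forall x, U x -> forall i j k : 'I_n,
      cov_deriv g (lie_deriv xi g) i j k x =
        2 * g x i j * partial k phi x + g x i k * partial j phi x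
        + g x j k * partial i phi x.

Definition homothety (U : set point) (g : tensor2) (xi : vfield) : Prop :=
  smooth_vfield U xi /\
  exists c : R, forall x, U x -> lie_deriv xi g x = c *: g x.

(* An r-dimensional real Lie algebra of smooth vector fields on U.  Since fields
   are total functions, they are identified when they agree on U: L is saturated
   for this relation, and a basis is independent and spanning modulo it. *)
Definition lie_algebra_of_dim (U : set point) (r : nat) (L : set vfield) : Prop :=
  [/\ forall xi, L xi -> smooth_vfield U xi,
      forall xi eta, L xi -> (forall x, U x -> xi x = eta x) -> L eta,
      L 0 /\ (forall (c : R) xi eta, L xi -> L eta -> L (c *: xi + eta)),
      forall xi eta, L xi -> L eta -> L (lie_bracket xi eta) &
      exists X : 'I_r -> vfield,
        [/\ forall a, L (X a),
            forall c : 'I_r -> R,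
              (forall x, U x -> \sum_a c a *: X a x = 0) -> forall a, c a = 0 &
            forall xi, L xi -> exists c : 'I_r -> R,
              forall x, U x -> xi x = \sum_a c a *: X a x]].

Definition nonhomothetic_projective_algebra
    (U : set point) (g : tensor2) (r : nat) (P : set vfield) : Prop :=
  [/\ lie_algebra_of_dim U r P,
      forall xi, P xi -> projective_motion U g xi &
      exists2 xi, P xi & ~ homothety U g xi].

End LocalGeometry.

Section HSpace33.
Variable R : realType.

(* The coordinate x^k is entry k-1 of a row vector. *)
Definition idx (k : nat) : 'I_6 := inZp k.-1.
Definition coord (k : nat) (x : 'rV[R]_6) : R := x ord0 (idx k).

(* Matrix of the quadratic form dx^j dx^k. *)
Definition dxdx (j k : nat) : 'M[R]_6 :=
  2^-1 *: (delta_mx (idx j) (idx k) + delta_mx (idx k) (idx j)).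

(* [epst] and [At] stand for epsilon and A with a tilde, [cst] for the constant a
   in f6. *)
Record h33_data := H33Data {
  e3 : R; e6 : R; eps : R; epst : R; cst : R; theta : R -> R; omega : R -> R }.

Variable d : h33_data.

Definition f3 (x : 'rV[R]_6) : R := eps d * coord 3 x.
Definition f6 (x : 'rV[R]_6) : R := epst d * coord 6 x + cst d.
Definition A (x : 'rV[R]_6) : R := eps d * coord 2 x + theta d (coord 3 x).
Definition At (x : 'rV[R]_6) : R := epst d * coord 5 x + omega d (coord 6 x).
Definition Sigma1 (x : 'rV[R]_6) : R := 3 * (f6 x - f3 x)^-1.
Definition Sigma2 (x : 'rV[R]_6) : R := 3 * (f6 x - f3 x) ^- 2.

Definition h33_metric (x : 'rV[R]_6) : 'M[R]_6 :=
  let u := eps d * coord 1 x in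
  let v := epst d * coord 4 x in
  (e3 d * (f6 x - f3 x) ^+ 3) *:
    (dxdx 2 2 + (4 * A x) *: dxdx 1 3
     + (2 * (u - 2 * A x * Sigma1 x)) *: dxdx 2 3
     + (u ^+ 2 - 4 * u * A x * Sigma1 x + 4 * A x ^+ 2 * Sigma2 x) *: dxdx 3 3)
  + (e6 d * (f3 x - f6 x) ^+ 3) *:
    (dxdx 5 5 + (4 * At x) *: dxdx 4 6
     + (2 * (v + 2 * At x * Sigma1 x)) *: dxdx 5 6
     + (v ^+ 2 + 4 * v * At x * Sigma1 x + 4 * At x ^+ 2 * Sigma2 x) *: dxdx 6 6).

(* The arbitrary functions need only be smooth, and nonzero where required, at
   the values actually taken by x^3, resp. x^6, on U.  The signature condition
   contains the nondegeneracy of the metric on U. *)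
Definition h33_space (U : set 'rV[R]_6) : Prop :=
  [/\ open U, connected U & U !=set0] /\
  [/\ e3 d = 1 \/ e3 d = -1, e6 d = 1 \/ e6 d = -1,
      eps d = 0 \/ eps d = 1 & epst d = 0 \/ epst d = 1] /\
  [/\ epst d = 0 -> cst d != 0,
      smooth_on (coord 3 @` U) (theta d),
      smooth_on (coord 6 @` U) (omega d),
      eps d = 0 -> (forall t, (coord 3 @` U) t -> theta d t != 0) &
      epst d = 0 -> (forall t, (coord 6 @` U) t -> omega d t != 0)] /\
  (forall x, U x -> has_signature 2 4 (h33_metric x)).

End HSpace33.

(* Main.v *)
(* Subtracting 2 phi g from b = L_xi g and raising the indices, the projective
   equation becomes a linear first order system for a symmetric s^{ij} and the
   gradient p^i of phi, in which the derivatives of s are determined by s and p.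
   If eps = epst = 0 the metric is flat.  Otherwise one may assume eps = 1, the two
   Jordan blocks being interchangeable; comparing two expressions for the same p^i
   and differentiating them then kills all components of s except those of a
   combination of g and of the tensor h defining the h-space, and shows that
   K = D^2 (s^22 + (e6/e3) s^55), D = f6 - f3, is constant; phi does not enter K.
   If K = 0 then phi is constant and b is a constant multiple of g.  Hence the
   linear functional xi |-> K(L_xi g) on P_r has exactly the homotheties of P_r as
   kernel, and these are closed under brackets. *)
Require Import Defs.
From mathcomp Require Import all_boot all_order all_algebra.
From mathcomp Require Import all_classical all_reals all_analysis.
From mathcomp Require Import ring lra.

Set Implicit Arguments.
Unset Strict Implicit.
Unset Printing Implicit Defensive.

Import Order.TTheory GRing.Theory Num.Theory.
Import numFieldNormedType.Exports.

Local Open Scope classical_set_scope.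
Local Open Scope ring_scope.

(** * Calculus on open sets *)

(** Why eps = 1 is needed: among the coefficients of the system only u = eps x^1 and A = eps x^2 +
    theta depend on x^1 or x^2, so differentiating a relation in one of these directions hits them
    and isolates a single component of s. Each such relation is first freed of p, which is therefore
    never differentiated, and the unknown first derivatives of s left in it are handled by the
    symmetry of second derivatives. The other parameter T = epst may be 0; division by it is avoided
    by choosing equations whose coefficients come from the first block.

    Where K comes from: if the mixed tensor s has eigenvalues l3 and l6 on the two blocks, then s^22
    = l3 / (e3 D^3) and s^55 = - l6 / (e6 D^3), so that e3 K = (l3 - l6) / D. A multiple of g has l3
    = l6 and is killed by K, while for the tensor of the h-space the eigenvalues differ by a
    multiple of D. Working with K instead of with the set of homotheties reduces the codimension to
    linear algebra. *)

Section DirectionalDerivative.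
Variables (R : realType) (V : normedModType R).
Implicit Types (f g : V -> R) (x v : V) (a b : R).

(** The rules are restated for functions written pointwise, so that a derivative can be computed by
    matching the shape of an expression. *)
Lemma derive_fcst x v a : is_derive x v (fun _ => a) 0.
Proof. exact: is_derive_cst. Qed.

Lemma derive_fD f g x v a b : is_derive x v f a -> is_derive x v g b ->
  is_derive x v (fun y => f y + g y) (a + b).
Proof. by move=> ? ?; exact: is_deriveD. Qed.

Lemma derive_fN f x v a : is_derive x v f a ->
  is_derive x v (fun y => - f y) (- a).
Proof. by move=> ?; exact: is_deriveN. Qed.

Lemma derive_fM f g x v a b : is_derive x v f a -> is_derive x v g b ->
  is_derive x v (fun y => f y * g y) (f x * b + g x * a).
Proof. by move=> ? ?; exact: is_deriveM. Qed.

Lemma derive_fV f x v a : f x != 0 -> is_derive x v f a ->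
  is_derive x v (fun y => (f y)^-1) (- (a * (f x)^-1 ^+ 2)).
Proof.
move=> fx0 [df <-]; apply: DeriveDef; first exact: derivableV.
by rewrite deriveV// /GRing.scale /= exprVn mulNr mulrC.
Qed.

Lemma derive_fX f x v a k : is_derive x v f a ->
  is_derive x v (fun y => f y ^+ k) (k%:R * f x ^+ k.-1 * a).
Proof.
move=> df; have -> : (fun y => f y ^+ k) = f ^+ k.
  by apply/funext => y; rewrite exprfctE.
exact: is_deriveX.
Qed.

Lemma derive_fsum (I : Type) (s : seq I) (f : I -> V -> R) (df : I -> R) x v :
  (forall i, is_derive x v (f i) (df i)) ->
  is_derive x v (fun y => \sum_(i <- s) f i y) (\sum_(i <- s) df i).
Proof.
move=> h; elim: s => [|i s IH].
  rewrite big_nil; under eq_fun do rewrite big_nil.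
  exact: derive_fcst.
rewrite big_cons; under eq_fun do rewrite big_cons.
exact: derive_fD.
Qed.

Lemma is_derive_unique f x v a b :
  is_derive x v f a -> is_derive x v f b -> a = b.
Proof. by move=> [_ <-] [_ <-]. Qed.

Variable U : set V.
Hypothesis openU : open U.

Lemma open_near x (P : V -> Prop) : U x -> (forall y, U y -> P y) ->
  \forall y \near x, P y.
Proof.
by move=> Ux h; apply: (filterS h); exact: open_nbhs_nbhs.
Qed.

Lemma is_derive_on f g x v a : (forall y, U y -> f y = g y) -> U x ->
  is_derive x v g a -> is_derive x v f a.
Proof.
move=> fg Ux dg; apply: (near_eq_is_derive (f := g)) => //.
by apply: open_near => // y Uy; rewrite fg.
Qed.

Lemma derive_on_unique f g x v a b : (forall y, U y -> f y = g y) -> U x ->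
  is_derive x v f a -> is_derive x v g b -> a = b.
Proof.
by move=> fg Ux df /(is_derive_on fg Ux); exact: is_derive_unique.
Qed.

Lemma derive_on f g x v : (forall y, U y -> f y = g y) -> U x ->
  'D_v f x = 'D_v g x.
Proof.
move=> fg Ux; apply: near_eq_derive.
by apply: open_near => // y Uy; rewrite fg.
Qed.

(** ['d g x] also satisfies the first-order expansion of [f] at [x]; uniqueness of the differential
    then identifies it with ['d f x]. *)
Lemma differentiable_on (W : normedModType R) (f g : V -> W) x :
  (forall y, U y -> f y = g y) -> U x ->
  differentiable g x -> differentiable f x.
Proof.
move=> fg Ux dg; have [dgc dgx] := (diff_locallyP _ _).1 dg.
have Ush : \forall h \near (0 : V), U (h + x).
  have : \forall y \near x, U y by exact: open_nbhs_nbhs.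
  by rewrite (near_shift 0 x) /= subr0.
have dfx : f \o shift x = cst (f x) + 'd g x +o_ 0 id.
  apply/eqaddoP => e e0; move/eqaddoP : dgx => /(_ e e0) dgx.
  near=> h.
  rewrite [X in `|X|](_ : _ = (g \o shift x - (cst (g x) + 'd g x)) h).
    by near: h.
  rewrite !fctE /= [f x]fg//; congr (_ - _).
  by apply: fg; near: h.
apply/diff_locallyP; rewrite (diff_unique dgc dfx).
by split.
Unshelve. all: by end_near. Qed.

End DirectionalDerivative.

(** * Algebra of smooth functions *)

Section Smoothness.
Variables (R : realType) (V : normedModType R) (U : set V).
Hypothesis openU : open U.
Implicit Types (f g : V -> R) (x v : V) (k : nat).

Lemma C_on_ext k f g : (forall y, U y -> f y = g y) -> C_on U k g -> C_on U k f.
Proof.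
elim: k f g => [|k IH] f g fg /=.
  move=> h x Ux; change (f @ x --> f x); rewrite fg//.
  apply: cvg_trans (h x Ux); apply: near_eq_cvg.
  by apply: (open_near openU) => // y Uy; rewrite fg.
move=> [dg hg]; split=> [x Ux|v].
  exact: (differentiable_on openU) fg Ux (dg x Ux).
by apply: IH (hg v) => y Uy; exact: (derive_on openU).
Qed.

Lemma C_onW k f : C_on U k.+1 f -> C_on U k f.
Proof.
elim: k f => [|k IH] f /= [df hf].
  by move=> x /df; exact: differentiable_continuous.
by split => // v; exact: IH (hf v).
Qed.

Lemma C_on_cst k a : C_on U k (fun _ => a : R).
Proof.
elim: k a => [|k IH] a /=; first by move=> x _; exact: cst_continuous.
split=> [x _|v]; first exact: differentiable_cst.
by apply: C_on_ext (IH 0) => y _; exact: derive_cst.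
Qed.

Lemma C_onD k f g : C_on U k f -> C_on U k g -> C_on U k (fun y => f y + g y).
Proof.
elim: k f g => [|k IH] f g /=.
  by move=> hf hg x Ux; apply: continuousD; [exact: hf|exact: hg].
move=> [df hf] [dg hg]; split=> [x Ux|v].
  by apply: differentiableD; [exact: df|exact: dg].
apply: C_on_ext (IH _ _ (hf v) (hg v)) => y Uy.
by apply: deriveD; apply: diff_derivable; [exact: df|exact: dg].
Qed.

Lemma C_onM k f g : C_on U k f -> C_on U k g -> C_on U k (fun y => f y * g y).
Proof.
elim: k f g => [|k IH] f g /=.
  by move=> hf hg x Ux; apply: continuousM; [exact: hf|exact: hg].
move=> [df hf] [dg hg]; split=> [x Ux|v].
  by apply: differentiableM; [exact: df|exact: dg].
have fk : C_on U k f by apply: C_onW.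
have gk : C_on U k g by apply: C_onW.
apply: C_on_ext (C_onD (IH _ _ fk (hg v)) (IH _ _ gk (hf v))) => y Uy.
by apply: deriveM; apply: diff_derivable; [exact: df|exact: dg].
Qed.

Lemma C_onV k f : (forall x, U x -> f x != 0) -> C_on U k f ->
  C_on U k (fun y => (f y)^-1).
Proof.
move=> f0; elim: k f f0 => [|k IH] f f0 /=.
  by move=> hf x Ux; apply: continuousV; [exact: f0|exact: hf].
move=> [df hf]; split=> [x Ux|v].
  by apply: differentiableV; [exact: df|exact: f0].
(* The derivative of the inverse contains the inverse itself, one order lower, which is the
   induction hypothesis. *)
have fk : C_on U k (fun y => (f y)^-1) by apply: IH => //; exact: C_onW.
apply: C_on_ext (C_onM (C_on_cst k (-1)) (C_onM (hf v) (C_onM fk fk))) => y Uy.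
rewrite deriveV; [|exact: f0|by apply: diff_derivable; exact: df].
by rewrite /GRing.scale /= mulN1r -expr2 exprVn mulNr mulrC.
Qed.

Lemma smooth_cst a : smooth_on U (fun _ => a : R).
Proof. by move=> k; exact: C_on_cst. Qed.

Lemma smooth_ext f g : (forall y, U y -> f y = g y) ->
  smooth_on U g -> smooth_on U f.
Proof. by move=> fg hg k; exact: C_on_ext fg (hg k). Qed.

Lemma smoothD f g : smooth_on U f -> smooth_on U g ->
  smooth_on U (fun y => f y + g y).
Proof. by move=> hf hg k; exact: C_onD. Qed.

Lemma smoothM f g : smooth_on U f -> smooth_on U g ->
  smooth_on U (fun y => f y * g y).
Proof. by move=> hf hg k; exact: C_onM. Qed.

Lemma smoothN f : smooth_on U f -> smooth_on U (fun y => - f y).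
Proof.
move=> hf; apply: smooth_ext (smoothM (smooth_cst (-1)) hf) => y _.
by rewrite mulN1r.
Qed.

Lemma smoothB f g : smooth_on U f -> smooth_on U g ->
  smooth_on U (fun y => f y - g y).
Proof. by move=> hf hg; apply: smoothD => //; exact: smoothN. Qed.

Lemma smoothV f : (forall x, U x -> f x != 0) -> smooth_on U f ->
  smooth_on U (fun y => (f y)^-1).
Proof. by move=> f0 hf k; exact: C_onV. Qed.

Lemma smoothX n f : smooth_on U f -> smooth_on U (fun y => f y ^+ n).
Proof.
move=> hf; elim: n => [|n IH]; first exact: smooth_cst.
by under eq_fun do rewrite exprS; exact: smoothM.
Qed.

Lemma smooth_sum (I : Type) (s : seq I) (f : I -> V -> R) :
  (forall i, smooth_on U (f i)) -> smooth_on U (fun y => \sum_(i <- s) f i y).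
Proof.
move=> hf; elim: s => [|i s IH].
  by under eq_fun do rewrite big_nil; exact: smooth_cst.
by under eq_fun do rewrite big_cons; exact: smoothD.
Qed.

Lemma smooth_derive v f : smooth_on U f -> smooth_on U (fun x => 'D_v f x).
Proof. by move=> hf k; case: (hf k.+1) => _; exact. Qed.

Lemma smooth_differentiable f x : smooth_on U f -> U x -> differentiable f x.
Proof. by move=> hf; have [+ _] := hf 1; apply. Qed.

Lemma smooth_is_derive f x v : smooth_on U f -> U x ->
  is_derive x v f ('D_v f x).
Proof.
by move=> hf Ux; apply/derivableP/diff_derivable; exact: smooth_differentiable.
Qed.

End Smoothness.

(** * Symmetry of second derivatives *)

Section Symmetry.
Variables (R : realType) (V : normedModType R) (U : set V).
Hypothesis openU : open U.
Implicit Types (f : V -> R) (x v w : V).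

Lemma derive_line f x v (t : R) :
  'D_(1 : R) (fun s : R => f (x + s *: v)) t = 'D_v f (x + t *: v).
Proof.
rewrite /derive.
set F := (X in lim (X @ _) = _); set G := (X in _ = lim (X @ _)).
suff -> : F = G by [].
apply/funext => h; rewrite /F /G /=.
by rewrite [h *: _]mulr1 scalerDl addrCA.
Qed.

Lemma is_derive_line f x v (t : R) : differentiable f (x + t *: v) ->
  is_derive t 1 (fun s : R => f (x + s *: v)) ('D_v f (x + t *: v)).
Proof.
move=> dfx; have df : derivable f (x + t *: v) v by exact: diff_derivable.
apply: DeriveDef; last exact: derive_line.
move: df; rewrite /derivable.
set F := (X in cvg (X @ _) -> _); set G := (X in _ -> cvg (X @ _)).
suff -> : F = G by [].
by apply/funext => h; rewrite /F /G /= [h *: (1 : R)]mulr1 scalerDl addrCA.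
Qed.

(* Mean value theorem in the direction v, then differentiability of D_v f. *)
Lemma second_difference f x v w e : U x ->
  (forall y, U y -> differentiable f y) -> differentiable ('D_v f) x ->
  0 < e -> \forall h \near (0 : R)^'+,
  `|f (x + h *: v + h *: w) - f (x + h *: v) - f (x + h *: w) + f x
    - h ^+ 2 * 'D_w ('D_v f) x| <= e * h ^+ 2 * (2 * `|v| + `|w|).
Proof.
move=> Ux df dF e0.
have [_ /eqaddoP/(_ e e0)] := (diff_locallyP _ _).1 dF.
rewrite -nbhs_nearE => /nbhs_norm0P[d1 /= d10 hd1].
have : \forall y \near x, U y by exact: open_nbhs_nbhs.
rewrite (near_shift 0 x) /= subr0 -nbhs_nearE => /nbhs_norm0P[d2 /= d20 hd2].
(* The summand 1 makes the bound [small] strict, as membership in the open balls requires. *)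
pose N := `|v| + `|w| + 1.
have N0 : 0 < N by rewrite ltr_wpDl// addr_ge0.
near=> h.
have h0 : 0 < h by near: h; exact: nbhs_right_gt.
have hN1 : h * N < d1.
  by rewrite -ltr_pdivlMr//; near: h; apply: nbhs_right_lt; rewrite divr_gt0.
have hN2 : h * N < d2.
  by rewrite -ltr_pdivlMr//; near: h; apply: nbhs_right_lt; rewrite divr_gt0.
have small (a b : R) : 0 <= a <= h -> 0 <= b <= h ->
    `|a *: v + b *: w| < h * N.
  move=> /andP[a0 ah] /andP[b0 bh]; apply: le_lt_trans (ler_normD _ _) _.
  rewrite !normrZ !ger0_norm// /N mulrDr mulr1 mulrDr ltr_pwDr//.
  by rewrite lerD// ler_wpM2r.
have inU a b : 0 <= a <= h -> 0 <= b <= h -> U (x + b *: w + a *: v).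
  move=> ha hb; rewrite -addrA addrC [b *: w + _]addrC.
  by apply: hd2 => /=; rewrite (lt_trans _ hN2)// small.
have h00 : (0 : R) <= 0 <= h by apply/andP; split => //; exact: ltW.
have hhh : 0 <= h <= h by apply/andP; split => //; exact: ltW.
(* The second difference is [phi h - phi 0], hence [h * dphi c] for some [c]. Both values of
   ['D_v f] in [dphi c] are expanded at [x]; the linear terms in [c] cancel and only errors
   remain. *)
pose phi := fun t : R => f (x + h *: w + t *: v) - f (x + t *: v).
pose dphi := fun t : R => 'D_v f (x + h *: w + t *: v) - 'D_v f (x + t *: v).
have isphi t : 0 <= t <= h -> is_derive t 1 phi (dphi t).
  move=> ht; apply: derive_fD; last apply: derive_fN;
    apply: is_derive_line; apply: df; first exact: inU.
  by have := inU t 0 ht h00; rewrite scale0r addr0.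
have [c ch hc] : exists2 c, c \in `]0, h[%R & phi h - phi 0 = dphi c * (h - 0).
  apply: MVT => //.
    move=> t; rewrite in_itv /= => /andP[t0 th]; apply: isphi.
    by rewrite !ltW.
  apply: derivable_within_continuous => t; rewrite in_itv /= => ht.
  by have [] := isphi t ht.
have {}ch : 0 <= c <= h.
  by move: ch; rewrite in_itv /= => /andP[? ?]; rewrite !ltW.
have est a b : 0 <= a <= h -> 0 <= b <= h ->
  `|'D_v f (x + b *: w + a *: v) - ('D_v f x + 'd ('D_v f) x (a *: v + b *: w))|
    <= e * `|a *: v + b *: w|.
  move=> ha hb; have /= := hd1 (a *: v + b *: w).
  rewrite !fctE /= (lt_trans (small a b ha hb) hN1) => /(_ isT).
  suff -> : x + b *: w + a *: v = a *: v + b *: w + x by [].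
  by rewrite [RHS]addrC -addrA [b *: w + _]addrC.
have e1 := est c h ch hhh; have e2 := est c 0 ch h00.
have -> : f (x + h *: v + h *: w) - f (x + h *: v) - f (x + h *: w) + f x
    = dphi c * h.
  rewrite subr0 in hc; rewrite -hc /phi scale0r !addr0.
  by rewrite [x + h *: v + _]addrAC; ring.
rewrite (deriveE _ dF).
set L := 'd ('D_v f) x.
have LE (a b : R) : L (a *: v + b *: w) = a * L v + b * L w.
  by rewrite linearD !linearZ.
move: e1 e2; rewrite !LE !scale0r !addr0 mul0r addr0.
rewrite normrZ (ger0_norm (andP ch).1) => e1 e2.
have e1' : e * `|c *: v + h *: w| <= e * (h * `|v| + h * `|w|).
  apply: ler_wpM2l; first exact: ltW.
  apply: le_trans (ler_normD _ _) _.
  rewrite !normrZ (ger0_norm (andP ch).1) (ger0_norm (ltW h0)) lerD2r.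
  by apply: ler_wpM2r => //; case/andP: ch.
have e2' : e * (c * `|v|) <= e * (h * `|v|).
  apply: ler_wpM2l; first exact: ltW.
  by apply: ler_wpM2r => //; case/andP: ch.
have -> : dphi c * h - h ^+ 2 * L w = h * (dphi c - h * L w) by ring.
rewrite normrM (ger0_norm (ltW h0)).
have -> : e * h ^+ 2 * (2 * `|v| + `|w|) =
  h * (e * (h * `|v| + h * `|w|) + e * (h * `|v|)) by ring.
apply: ler_wpM2l; first exact: ltW.
have -> : dphi c - h * L w =
  ('D_v f (x + h *: w + c *: v) - ('D_v f x + (c * L v + h * L w)))
  - ('D_v f (x + c *: v) - ('D_v f x + c * L v)) by rewrite /dphi; ring.
apply: le_trans (ler_normB _ _) _.
by apply: lerD; [exact: le_trans e1 e1'|exact: le_trans e2 e2'].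
Unshelve. all: by end_near. Qed.

(** The second difference is symmetric in [v] and [w], and divided by h^2 it approximates both
    iterated derivatives. *)
Lemma derive_comm f x v w : U x ->
  (forall y, U y -> differentiable f y) ->
  differentiable ('D_v f) x -> differentiable ('D_w f) x ->
  'D_w ('D_v f) x = 'D_v ('D_w f) x.
Proof.
move=> Ux df dv dw; apply/eqP; rewrite -subr_eq0 -normr_le0.
apply/ler_addgt0Pl => e e0; rewrite addr0.
(* The error constants for (v, w) and (w, v) added up; the 1 makes the sum positive. *)
pose C := (2 * `|v| + `|w|) + (2 * `|w| + `|v|) + 1.
have C0 : 0 < C by rewrite ltr_wpDl// !addr_ge0// mulr_ge0.
have eC : 0 < e / C by rewrite divr_gt0.
have [h [h0 h1 h2]] : exists h : R, [/\ 0 < h,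
  `|f (x + h *: v + h *: w) - f (x + h *: v) - f (x + h *: w) + f x
    - h ^+ 2 * 'D_w ('D_v f) x| <= e / C * h ^+ 2 * (2 * `|v| + `|w|) &
  `|f (x + h *: w + h *: v) - f (x + h *: w) - f (x + h *: v) + f x
    - h ^+ 2 * 'D_v ('D_w f) x| <= e / C * h ^+ 2 * (2 * `|w| + `|v|)].
  apply: (@filter_ex _ (0 : R)^'+); near=> h; split; near: h.
  - exact: nbhs_right_gt.
  - exact: second_difference.
  - exact: second_difference.
set a := 'D_w _ _ in h1 *; set b := 'D_v _ _ in h2 *.
have : `|h ^+ 2 * (a - b)| <= h ^+ 2 * e.
  rewrite [X in `|X|](_ : _ =
    (f (x + h *: w + h *: v) - f (x + h *: w) - f (x + h *: v) + f x
       - h ^+ 2 * b) -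
    (f (x + h *: v + h *: w) - f (x + h *: v) - f (x + h *: w) + f x
       - h ^+ 2 * a)); last by rewrite [x + h *: w + _]addrAC; ring.
  apply: le_trans (ler_normB _ _) _; apply: le_trans (lerD h2 h1) _.
  rewrite -mulrDr [_ * h ^+ 2]mulrC -mulrA; apply: ler_wpM2l.
    exact: sqr_ge0.
  rewrite -[leRHS](divfK (lt0r_neq0 C0)); apply: ler_wpM2l.
    exact: ltW.
  rewrite /C.
  by rewrite [X in X + 1]addrC lerDl.
by rewrite normrM ger0_norm ?sqr_ge0// ler_pM2l// exprn_gt0.
Unshelve. all: by end_near. Qed.

Lemma smooth_comm f x v w : smooth_on U f -> U x ->
  'D_w ('D_v f) x = 'D_v ('D_w f) x.
Proof.
move=> hf Ux; apply: derive_comm => //.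
- by move=> y; exact: (smooth_differentiable hf).
- exact: (smooth_differentiable (smooth_derive v hf)).
- exact: (smooth_differentiable (smooth_derive w hf)).
Qed.

End Symmetry.

(** * Functions with vanishing derivative *)

Section Constancy.
Variables (R : realType) (V : normedModType R) (U : set V).
Hypothesis openU : open U.
Implicit Types (f : V -> R) (x v : V).

Lemma locally_constant f x : U x -> (forall y, U y -> differentiable f y) ->
  (forall y v, U y -> 'D_v f y = 0) ->
  \forall y \near x, f y = f x.
Proof.
move=> Ux df D0.
have /nbhs_normP[e /= e0 he] : nbhs x U by exact: open_nbhs_nbhs.
rewrite -nbhs_nearE; apply/nbhs_normP; exists e => //= y ye.
pose k := y - x; have {}ye : `|k| < e by rewrite distrC.
have -> : y = x + 1 *: k by rewrite scale1r /k subrKC.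
have inU (t : R) : 0 <= t <= 1 -> U (x + t *: k).
  move=> /andP[t0 t1]; apply: he => /=.
  rewrite opprD addNKr normrN normrZ ger0_norm//; apply: le_lt_trans ye.
  by rewrite ler_piMl.
have isd (t : R) : 0 <= t <= 1 -> is_derive t 1 (fun s : R => f (x + s *: k)) 0.
  move=> ht; rewrite -(D0 (x + t *: k) k); last exact: inU.
  by apply: is_derive_line; apply: df; exact: inU.
have [||c _] := @MVT R (fun s : R => f (x + s *: k)) (fun=> 0) 0 1 ltr01.
- move=> t; rewrite in_itv /= => /andP[t0 t1]; apply: isd.
  by rewrite !ltW.
- apply: derivable_within_continuous => t; rewrite in_itv /= => ht.
  by have [] := isd t ht.
by rewrite mul0r scale0r addr0 => /eqP; rewrite subr_eq0 => /eqP.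
Qed.

Lemma connected_constant f x y : connected U -> U x -> U y ->
  (forall z, U z -> differentiable f z) ->
  (forall z v, U z -> 'D_v f z = 0) -> f x = f y.
Proof.
move=> cU Ux Uy df f0.
(* By local constancy this holds for every [P]; equality with [f y] and its negation make the level
   set both open and closed in [U]. *)
have opn (P : R -> Prop) : open [set z | U z /\ P (f z)].
  rewrite openE => z /= [Uz Pz]; rewrite /interior.
  have lc := locally_constant Uz df f0.
  have nU : \forall w \near z, U w by exact: open_nbhs_nbhs.
  rewrite nbhs_nearE; near=> w; split; first by near: w.
  by rewrite (_ : f w = f z)//; near: w.
suff UE : [set z | U z /\ f z = f y] = U by move: Ux; rewrite -UE => -[].
apply: cU; first by exists y.
  exists [set z | U z /\ f z = f y]; first exact: (opn (fun t => t = f y)).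
  by apply/seteqP; split=> z /=; tauto.
exists (~` [set z | U z /\ f z <> f y]).
  by apply: open_closedC; exact: (opn (fun t => t <> f y)).
apply/seteqP; split=> z /=; first tauto.
by move=> [Uz /not_andP[//|/contrapT]].
Unshelve. all: by end_near. Qed.

End Constancy.

(** * Partial derivatives and coordinate functions *)

Section RowVectors.
Variables (R : realType) (n : nat) (U : set 'rV[R]_n).
Hypothesis openU : open U.
Implicit Types (f : 'rV[R]_n -> R) (x v : 'rV[R]_n).

Lemma derive_partial f x v : differentiable f x ->
  'D_v f x = \sum_i v ord0 i * partial i f x.
Proof.
move=> df; rewrite deriveE// {1}(row_sum_delta v) linear_sum.
by apply: eq_bigr => i _; rewrite linearZ /partial deriveE.
Qed.

Lemma derive_coord (i : 'I_n) x v :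
  is_derive x v (fun y : 'rV[R]_n => y ord0 i) (v ord0 i).
Proof.
have dc : differentiable (fun y : 'rV[R]_n => y ord0 i) x.
  exact: differentiable_coord.
apply: DeriveDef; first exact: diff_derivable.
rewrite derive_partial// (bigD1 i)//= big1 ?addr0 => [|j ji].
  rewrite /partial; set w := delta_mx _ _.
  suff -> : 'D_w (fun y : 'rV[R]_n => y ord0 i) x = 1 by rewrite mulr1.
  rewrite /derive; apply/cvg_lim => //; apply: cvg_near_cst.
  near=> h; rewrite /= !mxE/= !eqxx/= [h * _]mulr1 addrK [_ *: _]mulVf//.
  by near: h; exact: nbhs_dnbhs_neq.
rewrite /partial; set w := delta_mx _ _.
suff -> : 'D_w (fun y : 'rV[R]_n => y ord0 i) x = 0 by rewrite mulr0.
rewrite /derive; apply/cvg_lim => //; apply: cvg_near_cst.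
near=> h; rewrite /= !mxE/= eq_sym (negbTE ji) /= mulr0 add0r subrr.
exact: scaler0.
Unshelve. all: by end_near. Qed.

Lemma smooth_coord (i : 'I_n) : smooth_on U (fun y : 'rV[R]_n => y ord0 i).
Proof.
case=> [|k] /=.
  by move=> x _; apply: differentiable_continuous; exact: differentiable_coord.
split=> [x _|v]; first exact: differentiable_coord.
apply: (C_on_ext openU) (C_on_cst openU k (v ord0 i)) => y _.
by have [] := derive_coord i y v.
Qed.

Lemma derive_comp_coord (h : R -> R) (i : 'I_n) x v :
  'D_v (fun y : 'rV[R]_n => h (y ord0 i)) x = 'D_(v ord0 i) h (x ord0 i).
Proof.
rewrite /derive.
set F := (X in lim (X @ _) = _); set G := (X in _ = lim (X @ _)).
suff -> : F = G by [].
by apply/funext => t; rewrite /F /G /= !mxE.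
Qed.

(** The induction closes because a directional derivative of a function of one coordinate is again a
    function of that coordinate. *)
Lemma smooth_comp_coord (h : R -> R) (i : 'I_n) :
  smooth_on ((fun y : 'rV[R]_n => y ord0 i) @` U) h ->
  smooth_on U (fun y : 'rV[R]_n => h (y ord0 i)).
Proof.
move=> hh k; elim: k h {hh}(hh k) => [|k IH] h /=.
  move=> hc x Ux; apply: continuous_comp; last by apply: hc; exists x.
  by apply: differentiable_continuous; exact: differentiable_coord.
move=> [dh hk]; split=> [x Ux|v].
  apply: differentiable_comp; first exact: differentiable_coord.
  by apply: dh; exists x.
apply: (C_on_ext openU) (IH _ (hk (v ord0 i))) => y Uy.
exact: derive_comp_coord.
Qed.

End RowVectors.

(** * Covariant derivatives and the Eisenhart equation *)

Section TensorCalculus.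
Variables (R : realType) (n : nat) (U : set 'rV[R]_n).
Hypothesis openU : open U.
Local Notation point := 'rV[R]_n.
Implicit Types (M N g b : point -> 'M[R]_n) (x : point) (k : 'I_n).

Definition dmx k M x : 'M[R]_n := \matrix_(i, j) partial k (fun y => M y i j) x.

Definition smooth_mx M := forall i j, smooth_on U (fun y => M y i j).

Lemma smooth_partial k (f : point -> R) x : smooth_on U f -> U x ->
  is_derive x (delta_mx ord0 k) f (partial k f x).
Proof. exact: smooth_is_derive. Qed.

Lemma partialE k (f : point -> R) x a :
  is_derive x (delta_mx ord0 k) f a -> partial k f x = a.
Proof. by case. Qed.

Lemma partial_ext k (f f' : point -> R) x : (forall y, U y -> f y = f' y) ->
  U x -> partial k f x = partial k f' x.
Proof. exact: (derive_on openU). Qed.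

Lemma dmx_ext k M N x : (forall y, U y -> M y = N y) -> U x ->
  dmx k M x = dmx k N x.
Proof.
move=> MN Ux; apply/matrixP => i j; rewrite !mxE.
by apply: partial_ext => // y Uy; rewrite MN.
Qed.

Lemma dmxD k M N x : smooth_mx M -> smooth_mx N -> U x ->
  dmx k (fun y => M y + N y) x = dmx k M x + dmx k N x.
Proof.
move=> sM sN Ux; apply/matrixP => i j; rewrite !mxE.
under [X in partial k X]eq_fun do rewrite mxE.
by apply/partialE/derive_fD; exact: smooth_partial.
Qed.

Lemma dmxN k M x : smooth_mx M -> U x ->
  dmx k (fun y => - M y) x = - dmx k M x.
Proof.
move=> sM Ux; apply/matrixP => i j; rewrite !mxE.
under [X in partial k X]eq_fun do rewrite mxE.
by apply/partialE/derive_fN; exact: smooth_partial.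
Qed.

Lemma dmxZ k (f : point -> R) M x : smooth_on U f -> smooth_mx M -> U x ->
  dmx k (fun y => f y *: M y) x = f x *: dmx k M x + partial k f x *: M x.
Proof.
move=> sf sM Ux; apply/matrixP => i j; rewrite !mxE.
under [X in partial k X]eq_fun do rewrite mxE.
rewrite [X in _ + X]mulrC.
by apply/partialE/derive_fM; exact: smooth_partial.
Qed.

Lemma dmxM k M N x : smooth_mx M -> smooth_mx N -> U x ->
  dmx k (fun y => M y *m N y) x = dmx k M x *m N x + M x *m dmx k N x.
Proof.
move=> sM sN Ux; apply/matrixP => i j; rewrite !mxE.
under [X in partial k X]eq_fun do rewrite mxE.
rewrite addrC -big_split /=; apply/partialE/derive_fsum => l; rewrite !mxE.
rewrite [X in _ + X]mulrC.
by apply: derive_fM; exact: smooth_partial.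
Qed.

Lemma smooth_mxM M N : smooth_mx M -> smooth_mx N ->
  smooth_mx (fun y => M y *m N y).
Proof.
move=> sM sN i j; under eq_fun do rewrite mxE.
by apply: smooth_sum => // l; apply: smoothM; [|exact: sM|exact: sN].
Qed.

Lemma smooth_mxD M N : smooth_mx M -> smooth_mx N ->
  smooth_mx (fun y => M y + N y).
Proof. move=> sM sN i j; under eq_fun do rewrite mxE.
by apply: smoothD; [|exact: sM|exact: sN]. Qed.

Lemma smooth_mxN M : smooth_mx M -> smooth_mx (fun y => - M y).
Proof. move=> sM i j; under eq_fun do rewrite mxE.
by apply: smoothN; last exact: sM. Qed.

Lemma smooth_mxZ (f : point -> R) M : smooth_on U f -> smooth_mx M ->
  smooth_mx (fun y => f y *: M y).
Proof. move=> sf sM i j; under eq_fun do rewrite mxE.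
by apply: smoothM; last exact: sM. Qed.

Lemma smooth_mx_tr M : smooth_mx M -> smooth_mx (fun y => (M y)^T).
Proof. by move=> sM i j; under eq_fun do rewrite mxE; exact: sM. Qed.

Lemma smooth_mx_ext M N : (forall y, U y -> M y = N y) -> smooth_mx N ->
  smooth_mx M.
Proof.
by move=> MN sN i j; apply: (smooth_ext openU) (sN i j) => y Uy; rewrite MN.
Qed.

Definition gammax g k x : 'M[R]_n := \matrix_(l, i) christoffel g l k i x.

Lemma cov_derivE g b i j k x : cov_deriv g b i j k x =
  (dmx k b x - (gammax g k x)^T *m b x - b x *m gammax g k x) i j.
Proof.
rewrite /cov_deriv !mxE; congr (_ - _ - _); apply: eq_bigr => l _.
  by rewrite !mxE.
by rewrite !mxE mulrC.
Qed.

(** Metric compatibility of the connection: lowering the upper index gives the symbols of the first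
    kind, and in the symmetrised sum all derivatives of [g] but one cancel. *)
Lemma metric_gammax g k x : (forall y, (g y)^T = g y) -> g x \in unitmx ->
  dmx k g x = (gammax g k x)^T *m g x + g x *m gammax g k x.
Proof.
move=> gT gu.
have gE i j y : g y i j = g y j i by rewrite -{1}gT mxE.
have pE a i j : partial a (fun y => g y i j) x = partial a (fun y => g y j i) x.
  by congr (partial a _ x); apply/funext => y.
have gG i j : (g x *m gammax g k x) i j = 2^-1 *
    (partial k (fun y => g y i j) x + partial j (fun y => g y i k) x
     - partial i (fun y => g y k j) x).
  rewrite mxE.
  transitivity ((g x *m (invmx (g x) *m \col_l (2^-1 *
    (partial k (fun y => g y l j) x + partial j (fun y => g y l k) x
     - partial l (fun y => g y k j) x)))) i ord0); last first.
    by rewrite mulKVmx// mxE.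
  rewrite [RHS]mxE; apply: eq_bigr => l _; rewrite mxE /christoffel [in RHS]mxE.
  congr (_ * _); rewrite mulr_sumr; apply: eq_bigr => m _.
  by rewrite mxE mulrCA.
have tr : (gammax g k x)^T *m g x = (g x *m gammax g k x)^T.
  by rewrite trmx_mul gT.
apply/matrixP => i j; rewrite tr [in RHS]mxE [X in X + _]mxE !gG mxE.
rewrite (pE k j i) (pE i j k) (pE j i k); lra.
Qed.

Section Contravariant.
Variables (g G b : point -> 'M[R]_n) (phi : point -> R).
Hypotheses (gT : forall y, (g y)^T = g y)
  (gG : forall y, U y -> g y *m G y = 1%:M).
Hypotheses (sg : smooth_mx g) (sG : smooth_mx G) (sb : smooth_mx b).
Hypothesis sphi : smooth_on U phi.
Hypothesis eisenhart : forall x, U x -> forall i j k : 'I_n,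
  cov_deriv g b i j k x = 2 * g x i j * partial k phi x
    + g x i k * partial j phi x + g x j k * partial i phi x.

(* Subtracting 2 phi g turns the Eisenhart equation into
   a_{ij,k} = g_ik phi_j + g_jk phi_i; [contra] is a with both indices raised, and
   for it the right-hand side becomes delta_ik p_j + delta_jk p_i. *)
Definition contra x : 'M[R]_n := G x *m (b x - (2 * phi x) *: g x) *m G x.

Definition contra_grad (i : 'I_n) x : R := \sum_l G x i l * partial l phi x.

Lemma smooth_contra : smooth_mx contra.
Proof.
do 2![apply: smooth_mxM => //]; apply: smooth_mxD => //; apply: smooth_mxN.
by apply: smooth_mxZ => //; apply: smoothM => //; exact: smooth_cst.
Qed.

(** With a = g s g, metric compatibility turns the covariant derivative of a into g (Ds) g, D being
    the covariant derivative; multiplying by [G] on both sides frees s from the metric. *)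
Lemma contra_eisenhart x k i j : U x ->
  partial k (fun y => contra y i j) x =
    (i == k)%:R * contra_grad j x + (j == k)%:R * contra_grad i x
    - \sum_l (christoffel g i k l x * contra x l j
              + christoffel g j k l x * contra x i l).
Proof.
move=> Ux; have gu : g x \in unitmx by case: (mulmx1_unit (gG Ux)).
have Gg y : U y -> G y *m g y = 1%:M by move=> Uy; exact/mulmx1C/gG.
set s := contra; set Gam := gammax g k x.
have ss : smooth_mx s := smooth_contra.
pose a y := b y - (2 * phi y) *: g y.
have sa : smooth_mx a.
  apply: smooth_mxD => //; apply: smooth_mxN; apply: smooth_mxZ => //.
  by apply: smoothM => //; exact: smooth_cst.
have aE y : U y -> a y = g y *m s y *m g y.
  move=> Uy; rewrite /s /contra -/(a y) !mulmxA gG// mul1mx -mulmxA Gg//.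
  by rewrite mulmx1.
have da : dmx k a x = dmx k g x *m s x *m g x + g x *m dmx k s x *m g x
    + g x *m s x *m dmx k g x.
  rewrite (dmx_ext k aE Ux) dmxM//; last exact: smooth_mxM.
  by rewrite dmxM// mulmxDl.
have cova : dmx k a x - Gam^T *m a x - a x *m Gam =
    g x *m (dmx k s x + Gam *m s x + s x *m Gam^T) *m g x.
  rewrite da (aE _ Ux) (metric_gammax k gT gu) -/Gam.
  rewrite !(mulmxDl, mulmxDr) !mulmxA.
  apply/matrixP => p q.
  move: (Gam^T *m _ *m _ *m _) (g x *m Gam *m _ *m _) (g x *m dmx k s x *m _).
  move=> A1 A2 A3; move: (g x *m s x *m Gam^T *m g x) (g x *m s x *m g x *m Gam).
  by move=> A4 A5; rewrite !mxE; ring.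
have covb : dmx k a x - Gam^T *m a x - a x *m Gam =
    \matrix_(p, q) (g x p k * partial q phi x + g x q k * partial p phi x).
  have -> : dmx k a x = dmx k b x - ((2 * phi x) *: dmx k g x
     + (2 * partial k phi x) *: g x).
    have s2 : smooth_on U (fun y => 2 * phi y).
      by apply: smoothM => //; exact: smooth_cst.
    rewrite dmxD ?dmxN ?dmxZ//; [|exact: smooth_mxZ|exact/smooth_mxN/smooth_mxZ].
    congr (_ - (_ + _ *: _)); apply/partialE.
    have := derive_fM (derive_fcst x (delta_mx ord0 k) 2)
      (smooth_partial k sphi Ux).
    by rewrite mulr0 addr0.
  rewrite (metric_gammax k gT gu) -/Gam /a mulmxBr mulmxBl -scalemxAr -scalemxAl.
  apply/matrixP => p q.
  rewrite [in RHS]mxE; have := eisenhart Ux p q k; rewrite cov_derivE -/Gam.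
  move: (Gam^T *m b x) (b x *m Gam) (Gam^T *m g x) (g x *m Gam) => A1 A2 A3 A4.
  by rewrite !mxE => h; lra.
have GT : (G x)^T = G x.
  by rewrite -[LHS]mulmx1 -(gG Ux) mulmxA -{1}gT -trmx_mul gG// trmx1 mul1mx.
pose w : 'rV[R]_n := \row_l partial l phi x.
pose dk : 'cV[R]_n := delta_mx k ord0.
have CE : \matrix_(p, q) (g x p k * partial q phi x + g x q k * partial p phi x)
    = g x *m dk *m w + w^T *m dk^T *m g x.
  apply/matrixP => p q; rewrite /dk trmx_delta -colE -mulmxA -rowE.
  rewrite !mxE !big_ord1 !mxE; congr (_ + _).
  by rewrite mulrC -[in LHS]gT mxE.
have key : dmx k s x + Gam *m s x + s x *m Gam^T =
    dk *m (w *m G x) + (G x *m w^T) *m dk^T.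
  have GXG (X : 'M[R]_n) : X = G x *m (g x *m X *m g x) *m G x.
    by rewrite !mulmxA Gg// mul1mx -mulmxA gG// mulmx1.
  rewrite [LHS]GXG -cova covb CE mulmxDr mulmxDl !mulmxA Gg// mul1mx.
  by rewrite -!mulmxA gG// mulmx1.
have wG j' : (w *m G x) ord0 j' = contra_grad j' x.
  rewrite mxE; apply: eq_bigr => l _; rewrite mxE mulrC; congr (_ * _).
  by rewrite -{1}GT mxE.
have Gw i' : (G x *m w^T) i' ord0 = contra_grad i' x.
  by rewrite mxE; apply: eq_bigr => l _; rewrite !mxE.
have -> : partial k (fun y => s y i j) x = dmx k s x i j by rewrite mxE.
move/matrixP/(_ i j) : key.
rewrite [X in _ = X]mxE [X in _ = X + _]mxE [X in _ = _ + X]mxE !big_ord1 wG Gw.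
rewrite [dk _ _]mxE [dk^T _ _]mxE [dk _ _]mxE !andbT.
rewrite [X in X = _ -> _]mxE [X in X + _ = _ -> _]mxE.
rewrite big_split /=.
have -> : \sum_l christoffel g i k l x * s x l j = (Gam *m s x) i j.
  by rewrite mxE; apply: eq_bigr => l _; rewrite [Gam _ _]mxE.
have -> : \sum_l christoffel g j k l x * s x i l = (s x *m Gam^T) i j.
  rewrite mxE; apply: eq_bigr => l _.
  by rewrite [Gam^T _ _]mxE [Gam _ _]mxE mulrC.
by move=> h; lra.
Qed.

End Contravariant.

End TensorCalculus.

(** * Lie derivatives *)

Section LieDerivative.
Variables (R : realType) (n : nat) (U : set 'rV[R]_n).
Hypothesis openU : open U.
Local Notation point := 'rV[R]_n.
Implicit Types (X Y : point -> point) (g : point -> 'M[R]_n) (f : point -> R).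
Implicit Types x : point.

Definition dir X f x : R := \sum_l X x ord0 l * partial l f x.

Definition dirmx X (M : point -> 'M[R]_n) x : 'M[R]_n :=
  \matrix_(i, j) dir X (fun y => M y i j) x.

Definition jacmx X x : 'M[R]_n :=
  \matrix_(l, i) partial i (fun y => X y ord0 l) x.

Lemma smooth_partial_fun k f : smooth_on U f -> smooth_on U (partial k f).
Proof. by move=> sf; apply: (smooth_derive (delta_mx ord0 k) sf). Qed.

Lemma partial_comm k l f x : smooth_on U f -> U x ->
  partial k (partial l f) x = partial l (partial k f) x.
Proof.
move=> sf Ux.
exact: (smooth_comm openU (delta_mx ord0 l) (delta_mx ord0 k) sf Ux).
Qed.

Lemma smooth_dir X f : smooth_vfield U X -> smooth_on U f ->
  smooth_on U (dir X f).
Proof.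
move=> sX sf; apply: smooth_sum => // l; apply: smoothM => //.
exact: smooth_partial_fun.
Qed.

Lemma smooth_jacmx X : smooth_vfield U X -> smooth_mx U (jacmx X).
Proof.
move=> sX l i; under eq_fun do rewrite mxE.
by apply: smooth_derive; exact: sX.
Qed.

Lemma smooth_dirmx X M : smooth_vfield U X -> smooth_mx U M ->
  smooth_mx U (dirmx X M).
Proof.
move=> sX sM i j; under eq_fun do rewrite mxE.
by apply: smooth_dir => //; exact: sM.
Qed.

Lemma lie_bracketE X Y x l : lie_bracket X Y x ord0 l =
  dir X (fun y => Y y ord0 l) x - dir Y (fun y => X y ord0 l) x.
Proof. by rewrite mxE sumrB. Qed.

Lemma partial_dir i X f x : smooth_vfield U X -> smooth_on U f -> U x ->
  partial i (dir X f) x =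
    \sum_m partial i (fun y => X y ord0 m) x * partial m f x
    + dir X (partial i f) x.
Proof.
move=> sX sf Ux; apply: partialE; rewrite /dir -big_split /=.
apply: derive_fsum => m; rewrite [X in X + _]mulrC addrC.
rewrite (partial_comm m i sf Ux).
apply: derive_fM; first exact: smooth_partial (sX m) Ux.
exact: smooth_partial (smooth_partial_fun m sf) Ux.
Qed.

(** The second-order parts of the two compositions are double sums that agree by symmetry of second
    derivatives; the first-order parts form the bracket. *)
Lemma dir_bracket X Y f x : smooth_vfield U X -> smooth_vfield U Y ->
  smooth_on U f -> U x ->
  dir (lie_bracket X Y) f x = dir X (dir Y f) x - dir Y (dir X f) x.
Proof.
move=> sX sY sf Ux.
have E X' Y' : smooth_vfield U X' -> smooth_vfield U Y' ->
    dir X' (dir Y' f) x = \sum_l dir X' (fun y => Y' y ord0 l) x * partial l f x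
      + \sum_m \sum_l X' x ord0 m * Y' x ord0 l * partial l (partial m f) x.
  move=> sX' sY'; rewrite {1}/dir.
  under eq_bigr do rewrite partial_dir// mulrDr.
  rewrite big_split /=; congr (_ + _).
    under eq_bigr do rewrite mulr_sumr.
    rewrite exchange_big; apply: eq_bigr => l _; rewrite mulr_suml.
    by apply: eq_bigr => m _; rewrite mulrA.
  apply: eq_bigr => m _; rewrite mulr_sumr; apply: eq_bigr => l _.
  by rewrite mulrA.
rewrite !E//; set S1 := \sum_m \sum_l _; set S2 := \sum_m \sum_l _.
have -> : S1 = S2.
  rewrite /S1 exchange_big; apply: eq_bigr => m _; apply: eq_bigr => l _.
  by rewrite [X x _ _ * _]mulrC (partial_comm m l sf Ux).
rewrite opprD addrACA subrr addr0 -sumrB; apply: eq_bigr => l _.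
by rewrite lie_bracketE mulrBl.
Qed.

Lemma lie_derivE X g x : lie_deriv X g x =
  dirmx X g x + (jacmx X x)^T *m g x + g x *m jacmx X x.
Proof.
apply/matrixP => i j; rewrite !mxE !big_split /=; congr (_ + _ + _).
  by apply: eq_bigr => l _; rewrite !mxE mulrC.
by apply: eq_bigr => l _; rewrite !mxE.
Qed.

Lemma jacmx_bracket X Y x : smooth_vfield U X -> smooth_vfield U Y -> U x ->
  jacmx (lie_bracket X Y) x = dirmx X (jacmx Y) x + jacmx Y x *m jacmx X x
    - (dirmx Y (jacmx X) x + jacmx X x *m jacmx Y x).
Proof.
move=> sX sY Ux; apply/matrixP => l i.
have D X' Y' : smooth_vfield U X' -> smooth_vfield U Y' ->
    partial i (dir X' (fun y => Y' y ord0 l)) x =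
    (dirmx X' (jacmx Y') x + jacmx Y' x *m jacmx X' x) l i.
  move=> sX' sY'; rewrite partial_dir// addrC !mxE; congr (_ + _).
    apply: eq_bigr => m _; congr (_ * partial m _ x).
    by apply/funext => y; rewrite mxE.
  by apply: eq_bigr => m _; rewrite !mxE mulrC.
rewrite [in RHS]mxE [X in _ = _ + X]mxE -!D// mxE.
under [X in partial i X]eq_fun do rewrite lie_bracketE.
apply/partialE/derive_fD; last apply: derive_fN.
  exact: smooth_partial (smooth_dir sX (sY l)) Ux.
exact: smooth_partial (smooth_dir sY (sX l)) Ux.
Qed.

Lemma dirD X f f' x : smooth_on U f -> smooth_on U f' -> U x ->
  dir X (fun y => f y + f' y) x = dir X f x + dir X f' x.
Proof.
move=> sf sf' Ux; rewrite /dir -big_split /=; apply: eq_bigr => l _.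
rewrite -mulrDr; congr (_ * _); apply/partialE/derive_fD; exact: smooth_partial.
Qed.

Lemma dirmxD X M N x : smooth_mx U M -> smooth_mx U N -> U x ->
  dirmx X (fun y => M y + N y) x = dirmx X M x + dirmx X N x.
Proof.
move=> sM sN Ux; apply/matrixP => i j; rewrite !mxE -dirD//.
by congr (dir X _ x); apply/funext => y; rewrite mxE.
Qed.

Lemma dirmxE X M x : dirmx X M x = \sum_l X x ord0 l *: dmx l M x.
Proof.
apply/matrixP => i j; rewrite mxE summxE; apply: eq_bigr => l _.
by rewrite !mxE.
Qed.

Lemma dirmxN X M x : smooth_mx U M -> U x ->
  dirmx X (fun y => - M y) x = - dirmx X M x.
Proof.
move=> sM Ux; rewrite !dirmxE -sumrN; apply: eq_bigr => l _.
by rewrite (dmxN l sM Ux) scalerN.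
Qed.

Lemma dirmxZ X c M x : smooth_mx U M -> U x ->
  dirmx X (fun y => c *: M y) x = c *: dirmx X M x.
Proof.
move=> sM Ux; rewrite !dirmxE scaler_sumr; apply: eq_bigr => l _.
rewrite (dmxZ l (smooth_cst openU c) sM Ux).
rewrite (partialE (derive_fcst x _ c)) scale0r addr0 !scalerA.
by rewrite mulrC.
Qed.

Lemma dirmxM X M N x : smooth_mx U M -> smooth_mx U N -> U x ->
  dirmx X (fun y => M y *m N y) x = dirmx X M x *m N x + M x *m dirmx X N x.
Proof.
move=> sM sN Ux; rewrite !dirmxE mulmx_suml mulmx_sumr -big_split /=.
apply: eq_bigr => l _; rewrite (dmxM l sM sN Ux) scalerDr.
by rewrite scalemxAl scalemxAr.
Qed.

Lemma dirmx_tr X M x : dirmx X (fun y => (M y)^T) x = (dirmx X M x)^T.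
Proof.
apply/matrixP => i j; rewrite !mxE.
by congr (dir X _ x); apply/funext => y; rewrite mxE.
Qed.

Lemma dirmx_ext X M N x : (forall y, U y -> M y = N y) -> U x ->
  dirmx X M x = dirmx X N x.
Proof.
move=> MN Ux; rewrite !dirmxE; apply: eq_bigr => l _.
by rewrite (dmx_ext openU l MN Ux).
Qed.

(** Both orders of taking Lie derivatives of g give cX cY g, so the commutator is zero. Concretely,
    X(g) = cX g - J^T g - g J, with J the Jacobian of X, removes all derivatives of [g]; what
    remains is an identity between matrix products. *)
Lemma lie_deriv_bracket X Y g cX cY x : smooth_mx U g ->
  smooth_vfield U X -> smooth_vfield U Y ->
  (forall y, U y -> lie_deriv X g y = cX *: g y) ->
  (forall y, U y -> lie_deriv Y g y = cY *: g y) ->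
  U x -> lie_deriv (lie_bracket X Y) g x = 0.
Proof.
move=> sg sX sY LX LY Ux.
have dE Z c : (forall y, U y -> lie_deriv Z g y = c *: g y) -> forall y, U y ->
    dirmx Z g y = c *: g y + - ((jacmx Z y)^T *m g y + g y *m jacmx Z y).
  by move=> LZ y Uy; rewrite -(LZ _ Uy) lie_derivE -[X in X - _]addrA addrK.
have ddE Z W c : smooth_vfield U Z -> smooth_vfield U W ->
    (forall y, U y -> lie_deriv Z g y = c *: g y) ->
    dirmx W (dirmx Z g) x = c *: dirmx W g x -
     ((dirmx W (jacmx Z) x)^T *m g x + (jacmx Z x)^T *m dirmx W g x
       + (dirmx W g x *m jacmx Z x + g x *m dirmx W (jacmx Z) x)).
  move=> sZ sW LZ; have sJ := smooth_jacmx sZ; have sJT := smooth_mx_tr sJ.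
  have s1 := smooth_mxM openU sJT sg; have s2 := smooth_mxM openU sg sJ.
  rewrite (dirmx_ext _ (dE _ _ LZ) Ux) dirmxD ?dirmxN ?dirmxD ?dirmxM ?dirmxZ//.
  - by rewrite dirmx_tr.
  - exact: smooth_mxD.
  - by apply: smooth_mxZ => //; exact: smooth_cst.
  - by apply: smooth_mxN => //; exact: smooth_mxD.
rewrite lie_derivE jacmx_bracket//.
have -> : dirmx (lie_bracket X Y) g x =
    dirmx X (dirmx Y g) x - dirmx Y (dirmx X g) x.
  have dirE Z W i j : dir Z (fun y => dirmx W g y i j) x
      = dir Z (dir W (fun y => g y i j)) x.
    by congr (dir Z _ x); apply/funext => y; rewrite mxE.
  by apply/matrixP => i j; rewrite !mxE !dirE dir_bracket//; exact: sg.
rewrite (ddE _ _ _ sX sY LX) (ddE _ _ _ sY sX LY).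
rewrite !(dE _ _ LX x Ux) !(dE _ _ LY x Ux).
move: (jacmx X x) (jacmx Y x) (dirmx X (jacmx Y) x) (dirmx Y (jacmx X) x) (g x).
move=> JX JY DX DY G.
rewrite [(_ - _)^T]linearB /= [(DX + _)^T]linearD [(DY + _)^T]linearD /=.
rewrite !trmx_mul.
rewrite !(mulmxDl, mulmxDr, mulmxN, mulNmx) -!scalemxAl -!scalemxAr !mulmxA.
move: (DX^T *m G) (DY^T *m G) (G *m DX) (G *m DY) => M1 M2 M3 M4.
move: (JX^T *m JY^T *m G) (JY^T *m JX^T *m G) => M5 M6.
move: (G *m JX *m JY) (G *m JY *m JX) => M7 M8.
move: (JX^T *m G *m JY) (JY^T *m G *m JX) => M9 M10.
move: (JX^T *m G) (JY^T *m G) (G *m JX) (G *m JY) => N1 N2 N3 N4.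
by apply/matrixP => i j; rewrite !mxE; ring.
Qed.

End LieDerivative.

(** * The kernel of a linear functional on a Lie algebra of fields *)

Section LinearFunctional.
Variables (R : realType) (n : nat) (U : set 'rV[R]_n).
Local Notation vfield := ('rV[R]_n -> 'rV[R]_n).
Variables (P : set vfield) (lam : vfield -> R).
Hypothesis lam_lin : forall (c : R) xi eta, P xi -> P eta ->
  lam (c *: xi + eta) = c * lam xi + lam eta.
Hypothesis lam_ext : forall xi eta, P xi -> P eta ->
  (forall x, U x -> xi x = eta x) -> lam xi = lam eta.
Hypothesis lam_bracket : forall xi eta, P xi -> P eta ->
  lam xi = 0 -> lam eta = 0 -> lam (lie_bracket xi eta) = 0.

Lemma lie_algebra_kernel_succ m xi0 : lie_algebra_of_dim U m.+1 P ->
  P xi0 -> lam xi0 != 0 ->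
  lie_algebra_of_dim U m [set xi | P xi /\ lam xi = 0].
Proof.
move=> [Psm Pext [P0 Plin] Pbr [X' [PX' free span]]] Pxi0 lam0.
have lam00 : lam 0 = 0.
  have /eqP := lam_lin 1 P0 P0.
  by rewrite scaler0 addr0 mul1r -subr_eq subrr eq_sym => /eqP.
have lincomb (I : Type) (s : seq I) (c : I -> R) (Y : I -> vfield) :
    (forall i, P (Y i)) -> P (\sum_(i <- s) c i *: Y i) /\
    lam (\sum_(i <- s) c i *: Y i) = \sum_(i <- s) c i * lam (Y i).
  move=> PY; elim: s => [|i s [IH1 IH2]]; first by rewrite !big_nil.
  by rewrite !big_cons lam_lin// IH2; split => //; exact: Plin.
have sumE (I : Type) (s : seq I) (c : I -> R) (Y : I -> vfield) x :
    (\sum_(i <- s) c i *: Y i) x = \sum_(i <- s) c i *: Y i x.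
  by elim/big_rec2: _ => // i y1 y2 _ <-.
have lamE xi (c : 'I_m.+1 -> R) : P xi ->
    (forall x, U x -> xi x = \sum_a c a *: X' a x) ->
    lam xi = \sum_a c a * lam (X' a).
  move=> Pxi h; have [P1 <-] := lincomb _ (index_enum 'I_m.+1) c X' PX'.
  by apply: lam_ext => // x Ux; rewrite h// sumE.
have [a0 la0] : exists a, lam (X' a) != 0.
  apply/existsP; apply: contraNT lam0; rewrite negb_exists => /forallP z.
  have [c hc] := span _ Pxi0; rewrite (lamE _ _ Pxi0 hc) big1// => a _.
  by have := z a; rewrite negbK => /eqP ->; rewrite mulr0.
split.
- by move=> xi [/Psm].
- move=> xi eta [Pxi lxi] h; have Peta := Pext _ _ Pxi h.
  by split=> //; rewrite -(lam_ext Pxi Peta h).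
- split=> // c xi eta [Pxi lxi] [Peta leta]; split; first exact: Plin.
  by rewrite lam_lin// lxi leta mulr0 addr0.
- by move=> xi eta [Pxi lxi] [Peta leta]; split; [exact: Pbr|exact: lam_bracket].
(* Gaussian elimination with pivot [a0]: subtracting [mu a] times the pivot field moves every other
   basis field into the kernel. *)
pose mu a := lam (X' a) / lam (X' a0).
exists (fun b : 'I_m => (- mu (lift a0 b)) *: X' a0 + X' (lift a0 b)); split.
- move=> b; split; first exact: Plin.
  by rewrite lam_lin// /mu mulNr divfK// addNr.
- move=> c hc.
  (* The pivot coefficient collects the corrections, so a relation among the new fields becomes one
     among the old. *)
  pose c' a := if unlift a0 a is Some b then c b
               else - \sum_b c b * mu (lift a0 b).
  have hc' x : U x -> \sum_a c' a *: X' a x = 0.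
    move=> Ux; rewrite -[RHS](hc x Ux) (bigD1_ord a0) //= {1}/c' unlift_none.
    under eq_bigr do rewrite /c' liftK.
    under [RHS]eq_bigr do rewrite !fctE scalerDr scalerA mulrN scaleNr.
    by rewrite big_split /= sumrN scaleNr scaler_suml.
  by move=> b; have := free c' hc' (lift a0 b); rewrite /c' liftK.
move=> xi [Pxi lxi]; have [c hc] := span xi Pxi.
exists (fun b => c (lift a0 b)) => x Ux.
have := lamE _ _ Pxi hc; rewrite lxi (bigD1_ord a0) //= => /esym/eqP.
rewrite addr_eq0 => /eqP c0.
have {}c0 : c a0 = - \sum_b c (lift a0 b) * mu (lift a0 b).
  rewrite -[LHS](mulfK la0) c0 mulNr mulr_suml; congr (- _).
  by apply: eq_bigr => b _; rewrite mulrA.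
rewrite hc// (bigD1_ord a0) //= c0.
under [RHS]eq_bigr do rewrite !fctE scalerDr scalerA mulrN scaleNr.
by rewrite big_split /= sumrN scaleNr scaler_suml.
Qed.

Lemma lie_algebra_kernel r xi0 : lie_algebra_of_dim U r P ->
  P xi0 -> lam xi0 != 0 ->
  lie_algebra_of_dim U r.-1 [set xi | P xi /\ lam xi = 0].
Proof.
(* For r = 0 every element agrees with 0 on [U], so [lam xi0] would vanish; the truncated [r.-1]
   does no harm. *)
case: r => [|m]; last exact: lie_algebra_kernel_succ.
move=> [_ _ [P0 Plin] _ [X [_ _ span]]] Pxi0; have [c hc] := span _ Pxi0.
have /eqP := lam_lin 1 P0 P0.
rewrite scaler0 addr0 mul1r -subr_eq subrr => /eqP lam00.
rewrite (lam_ext Pxi0 P0) -?lam00 ?eqxx// => x Ux.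
by rewrite hc// big_ord0.
Qed.

End LinearFunctional.

(** * Coordinate tables of the [33] metric *)

Section ChristoffelTable.
Variable R : fieldType.
Implicit Types (E T c e A iA B iB D iD u v t w : R).

Definition swap6 (i : nat) : nat :=
  match i with
  | 1 => 4 | 2 => 5 | 3 => 6 | 4 => 1 | 5 => 2 | 6 => 3 | _ => i
  end%N.

(* [gamma_block .. i j k] is Gamma^i_{jk} for i in the first block, indices
   running over 1..6.  Here D = f6 - f3, u = eps x^1, v = epst x^4, t = theta',
   E = eps, T = epst, e = e6 / e3, and iA, iB, iD stand for the inverses of
   A, B = A-tilde and D.  Exchanging the two blocks maps D to -D, so the rows of
   the second block are the same expressions with the data swapped. *)
Definition gamma_block E T e A iA B iD u v t (i j k : nat) : R :=
  match i, j, k with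
  | 1, 1, 2 | 1, 2, 1 => (3 / 4 * E * iA)%R
  | 1, 1, 3 | 1, 3, 1 => (E * (3 / 4 * u * iA - 9 / 2 * iD))%R
  | 1, 1, 6 | 1, 6, 1 => (3 / 2 * T * iD)%R
  | 1, 2, 2 => (- (9 / 4) * E * iA * iD)%R
  | 1, 2, 3 | 1, 3, 2 => (E * (9 / 2 * iD ^+ 2 - 9 / 4 * u * iA * iD))%R
  | 1, 2, 6 | 1, 6, 2 => (3 / 2 * T * iD ^+ 2)%R
  | 1, 3, 3 => (E *
      (9 * u * iD ^+ 2 - 3 * A * iD ^+ 3 - 9 / 4 * u ^+ 2 * iA * iD))%R
  | 1, 3, 6 | 1, 6, 3 => (T * (3 * A * iD ^+ 3 + 3 / 2 * u * iD ^+ 2))%R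
  | 1, 4, 6 | 1, 6, 4 => (- (3 / 2) * E * e * B * iA * iD)%R
  | 1, 5, 5 => (- (3 / 4) * E * e * iA * iD)%R
  | 1, 5, 6 | 1, 6, 5 => (- E * e * iA * (3 * B * iD ^+ 2 + 3 / 4 * v * iD))%R
  | 1, 6, 6 => (- E * e * iA *
      (3 * B ^+ 2 * iD ^+ 3 + 6 * v * B * iD ^+ 2 + 3 / 4 * v ^+ 2 * iD))%R
  | 2, 1, 3 | 2, 3, 1 => (- (1 / 2) * E)%R
  | 2, 2, 3 | 2, 3, 2 => (- (1 / 4) * E * u * iA)%R
  | 2, 2, 6 | 2, 6, 2 => (3 / 2 * T * iD)%R
  | 2, 3, 3 => (1 / 2 * E * u ^+ 2 * iA - u * iA * t)%R
  | 2, 3, 6 | 2, 6, 3 => (3 * T * A * iD ^+ 2)%R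
  | 3, 2, 3 | 3, 3, 2 => (1 / 4 * E * iA)%R
  | 3, 3, 3 => (iA * t - 1 / 2 * E * u * iA)%R
  | 3, 3, 6 | 3, 6, 3 => (3 / 2 * T * iD)%R
  | _, _, _ => (0)%R
  end%N.

Definition gamma_table E T e ie A iA B iB iD u v t w (i j k : nat) : R :=
  match i with
  | 1 | 2 | 3 => (gamma_block E T e A iA B iD u v t i j k)%R
  | _ => (gamma_block T E ie B iB A (- iD) v u w (swap6 i) (swap6 j) (swap6 k))%R
  end%N.

(* Gram matrix of one block with c = e3; the entries are polynomial because
   D^3 Sigma1 = 3 D^2 and D^3 Sigma2 = 3 D. *)
Definition gram_block c A D u (i j : nat) : R :=
  match i, j with
  | 1, 3 | 3, 1 => (2 * c * A * D ^+ 3)%R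
  | 2, 2 => (c * D ^+ 3)%R
  | 2, 3 | 3, 2 => (c * (u * D ^+ 3 - 6 * A * D ^+ 2))%R
  | 3, 3 =>
    (c * (u ^+ 2 * D ^+ 3 - 12 * u * A * D ^+ 2 + 12 * A ^+ 2 * D))%R
  | _, _ => 0%R
  end%N.

Definition gram_table c c' A B D u v (i j : nat) : R :=
  match i with
  | 1 | 2 | 3 => gram_block c A D u i j
  | _ => gram_block c' B (- D) v (swap6 i) (swap6 j)
  end%N.

(** The Leibniz derivative of [gram_block], where [dA], [dD] and [du] are the derivatives of its
    arguments in a common direction. *)
Definition dgram_block c A D u dA dD du (i j : nat) : R :=
  match i, j with
  | 1, 3 | 3, 1 => (2 * c * (dA * D ^+ 3 + 3 * A * D ^+ 2 * dD))%R
  | 2, 2 => (3 * c * D ^+ 2 * dD)%R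
  | 2, 3 | 3, 2 => (c * (du * D ^+ 3 + 3 * u * D ^+ 2 * dD
      - 6 * dA * D ^+ 2 - 12 * A * D * dD))%R
  | 3, 3 => (c * (2 * u * du * D ^+ 3 + 3 * u ^+ 2 * D ^+ 2 * dD
      - 12 * (du * A + u * dA) * D ^+ 2 - 24 * u * A * D * dD
      + 24 * A * dA * D + 12 * A ^+ 2 * dD))%R
  | _, _ => 0%R
  end%N.

Definition dgram_table c c' A B D u v dA dB dD du dv (i j : nat) : R :=
  match i with
  | 1 | 2 | 3 => dgram_block c A D u dA dD du i j
  | _ => dgram_block c' B (- D) v dB (- dD) dv (swap6 i) (swap6 j)
  end%N.

Definition grad_A E t (k : nat) : R :=
  match k with 2 => E | 3 => t | _ => 0%R end%N.
Definition grad_B T w (k : nat) : R :=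
  match k with 5 => T | 6 => w | _ => 0%R end%N.
Definition grad_D E T (k : nat) : R :=
  match k with 3 => (- E)%R | 6 => T | _ => 0%R end%N.
Definition grad_u E (k : nat) : R := if k is 1%N then E else 0.
Definition grad_v T (k : nat) : R := if k is 4%N then T else 0.

Definition sum6 (F : nat -> R) : R :=
  F 1%N + F 2%N + F 3%N + F 4%N + F 5%N + F 6%N.

(** The inverse of [gram_block], polynomial in the inverses [iA] and [iD]; [c] is here the inverse
    of the constant used there. *)
Definition ginv_block c iA iD u (i j : nat) : R :=
  match i, j with
  | 1, 1 => (6 * c * iD ^+ 5)%R
  | 1, 2 | 2, 1 => (c * iD ^+ 3 * (3 * iD - 1 / 2 * u * iA))%R
  | 1, 3 | 3, 1 => (1 / 2 * c * iA * iD ^+ 3)%R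
  | 2, 2 => (c * iD ^+ 3)%R
  | _, _ => 0%R
  end%N.

Definition ginv_table c c' iA iB iD u v (i j : nat) : R :=
  match i with
  | 1 | 2 | 3 => ginv_block c iA iD u i j
  | _ => ginv_block c' iB (- iD) v (swap6 i) (swap6 j)
  end%N.

End ChristoffelTable.

Section TableIdentities.
Variables (R : realFieldType) (c c' E T A B D u v t w : R).
Hypotheses (c0 : c != 0) (c'0 : c' != 0) (A0 : A != 0) (B0 : B != 0)
  (D0 : D != 0).

Definition dgram (k i j : nat) : R :=
  dgram_table c c' A B D u v (grad_A E t k) (grad_B T w k) (grad_D E T k)
    (grad_u E k) (grad_v T k) i j.

Lemma gram_ginv i j : (0 < i <= 6)%N -> (0 < j <= 6)%N ->
  sum6 (fun m => gram_table c c' A B D u v i m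
    * ginv_table c^-1 c'^-1 A^-1 B^-1 D^-1 u v m j) = (i == j)%:R.
Proof.
move: i => [|[|[|[|[|[|[|//]]]]]]]// _; move: j => [|[|[|[|[|[|[|//]]]]]]]// _;
rewrite /sum6 /gram_table /ginv_table /gram_block /ginv_block /=;
field; by rewrite ?A0 ?B0 ?D0 ?c0 ?c'0.
Qed.

(** Koszul's formula with the upper index lowered: the table of Christoffel symbols is certified
    without the inverse metric. *)
Lemma gram_gamma i j k : (0 < i <= 6)%N -> (0 < j <= 6)%N -> (0 < k <= 6)%N ->
  dgram j i k + dgram k i j - dgram i j k =
  2 * sum6 (fun m => gram_table c c' A B D u v i m
    * gamma_table E T (c' / c) (c / c') A A^-1 B B^-1 D^-1 u v t w m j k).
Proof.
move: i => [|[|[|[|[|[|[|//]]]]]]]// _; move: j => [|[|[|[|[|[|[|//]]]]]]]// _;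
move: k => [|[|[|[|[|[|[|//]]]]]]]// _;
rewrite /sum6 /dgram /gram_table /dgram_table /gamma_table /gram_block
  /dgram_block /gamma_block /=;
field; by rewrite ?A0 ?B0 ?D0 ?c0 ?c'0.
Qed.

End TableIdentities.

(** * Solutions of the Eisenhart equation when the first block is nontrivial *)

Section TwoBlockSystem.
Variables (R : realType) (V : normedModType R) (U : set V).
Hypothesis openU : open U.
Variables (dv : nat -> V) (A B D u v t w : V -> R) (e T : R).
Variables (s : nat -> nat -> V -> R) (p : nat -> V -> R).

(** Only entries with i <= j occur, so that [s i j] and [s j i] become the same atom for [lra]. *)
Definition usym (i j : nat) : V -> R := if Nat.leb i j then s i j else s j i.

Definition gam (y : V) : nat -> nat -> nat -> R :=
  gamma_table 1 T e e^-1 (A y) (A y)^-1 (B y) (B y)^-1 (D y)^-1 (u y) (v y) (t y)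
    (w y).

Definition eisenhart_rhs (k i j : nat) (y : V) : R :=
  (if Nat.eqb i k then p j y else 0) + (if Nat.eqb j k then p i y else 0)
  - sum6 (fun l => gam y i k l * usym l j y + gam y j k l * usym i l y).

Hypotheses (A0 : forall y, U y -> A y != 0) (B0 : forall y, U y -> B y != 0)
  (D0 : forall y, U y -> D y != 0) (e0 : e != 0).
Hypothesis ss : forall i j, smooth_on U (s i j).

Definition derives (f : V -> R) (df : nat -> V -> R) : Prop :=
  forall k y, (0 < k <= 6)%N -> U y -> is_derive y (dv k) f (df k y).

Hypotheses (dA : derives A (fun k y => grad_A 1 (t y) k))
  (dB : derives B (fun k y => grad_B T (w y) k))
  (dD : derives D (fun k y => grad_D 1 T k))
  (du : derives u (fun k y => grad_u 1 k))
  (dv_v : derives v (fun k y => grad_v T k))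
  (dw : forall k y, U y -> k = 1%N \/ k = 2%N -> is_derive y (dv k) w 0).

Hypothesis eqn : forall k i j y, (0 < k <= 6)%N -> (0 < i <= 6)%N ->
  (0 < j <= 6)%N -> U y -> 'D_(dv k) (s i j) y = eisenhart_rhs k i j y.

(** An equation of the system gives ['D_(dv k) f]; by symmetry of second derivatives this also gives
    the derivative along k of the unknown ['D_(dv l) f], so relations containing that unknown can be
    differentiated. *)
Lemma is_derive_swap f (f' : V -> R) k l y c : smooth_on U f -> U y ->
  (forall z, U z -> 'D_(dv k) f z = f' z) ->
  is_derive y (dv l) f' c -> is_derive y (dv k) ('D_(dv l) f) c.
Proof.
move=> sf Uy ff' df'.
have -> : c = 'D_(dv k) ('D_(dv l) f) y.
  rewrite (smooth_comm openU (dv l) (dv k) sf Uy).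
  by have [_ <-] := is_derive_on openU ff' Uy df'.
exact: smooth_is_derive (smooth_derive (dv l) sf) Uy.
Qed.


Ltac neq0 Uy :=
  rewrite ?mulf_neq0 ?invr_neq0 ?expf_neq0 ?(A0 Uy) ?(B0 Uy) ?(D0 Uy) ?e0
    ?pnatr_eq0 //.

(** The facts produced by [swapped] are picked up by [eassumption]; the last clause leaves the first
    derivatives of [s] as unknowns. *)
Ltac der Uy := repeat first
  [ eassumption
  | apply derive_fcst
  | apply derive_fD
  | apply derive_fN
  | apply derive_fM
  | apply derive_fX
  | (apply derive_fV; [solve [neq0 Uy] |])
  | (first [refine (dA _ Uy) | refine (dB _ Uy) | refine (dD _ Uy)
           | refine (du _ Uy) | refine (dv_v _ Uy)]; first [exact isT | assumption])
  | exact (dw Uy (or_introl erefl)) | exact (dw Uy (or_intror erefl))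
  | exact (smooth_is_derive (dv _) (ss _ _) Uy) ].

Ltac simplify_table :=
  rewrite /eisenhart_rhs /sum6 /usym /gam /gamma_table /gamma_block /=.

Ltac eqn_ kij Uy :=
  match kij with (?k, ?i, ?j) =>
    generalize (@eqn k i j _ isT isT isT Uy); simplify_table
  end.

Ltac differentiate k H Uy :=
  generalize (derive_on_unique openU (v := dv k) H Uy
                ltac:(der Uy) ltac:(der Uy)); rewrite /=.

Ltac swapped k l ij Uy H h :=
  pose proof (is_derive_swap (k := k) (l := l) ij Uy H ltac:(der Uy)) as h;
  simpl in h.


Lemma mulf_cancel0 (c x : R) : c != 0 -> c * x = 0 -> x = 0.
Proof. by move=> c0 /eqP; rewrite mulf_eq0 (negbTE c0) => /eqP. Qed.

Lemma derive_eq0 (f : V -> R) z y : (forall x, U x -> f x = 0) -> U y ->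
  'D_z f y = 0.
Proof.
by move=> f0 Uy; rewrite (derive_on openU z f0 Uy); exact: derive_cst.
Qed.

(* The equations (k; i j) = (2; 2 3) and (5; 3 5) both compute p 3; their
   x^1-derivatives differ by a nonzero multiple of s 3 3.  The vanishing of
   s 2 3, s 3 4, s 3 5, s 3 6, s 2 4, s 2 5 and s 2 6 follows the same pattern,
   with x^1- or x^2-derivatives. *)
Lemma s33_eq0 y : U y -> s 3 3 y = 0.
Proof.
move=> Uy.
have H z : U z -> 'D_(dv 2) (s 2 3) z + (- (1/4) * u z / A z * s 3 3 z
      + 3/2 * T / D z * s 3 6 z + 1/4 / A z * s 2 3 z)
    = 'D_(dv 5) (s 3 5) z - 3/2 / D z * s 3 3 z
      - 1/4 * T * v z / B z * s 3 6 z.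
  by move=> Uz; eqn_ (2, 2, 3)%N Uz; eqn_ (5, 3, 5)%N Uz; lra.
have d23 z : U z -> 'D_(dv 1) (s 2 3) z = 1/2 * s 3 3 z.
  by move=> Uz; eqn_ (1, 2, 3)%N Uz; lra.
have d35 z : U z -> 'D_(dv 1) (s 3 5) z = 0.
  by move=> Uz; eqn_ (1, 3, 5)%N Uz; lra.
swapped 1%N 2%N (ss 2 3) Uy d23 h23.
swapped 1%N 5%N (ss 3 5) Uy d35 h35.
differentiate 1%N H Uy; rewrite !eqn//; simplify_table => h.
by apply: (@mulf_cancel0 (A y)^-1); [neq0 Uy|lra].
Qed.

(** Once [s 3 j] vanishes identically, its derivative drops out of the equation (3; 3 j), which then
    gives [p j] algebraically. The lemmas [p5E], [p6E] and [p4E] arise in the same way. *)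
Lemma p3E y : U y -> p 3 y = 1/4 / A y * s 2 3 y + 3/2 * T / D y * s 3 6 y.
Proof.
move=> Uy; eqn_ (3, 3, 3)%N Uy; rewrite (derive_eq0 _ s33_eq0 Uy) s33_eq0//.
by lra.
Qed.

Lemma s23_eq0 y : U y -> s 2 3 y = 0.
Proof.
move=> Uy.
have H z : U z -> 1/4 / A z * s 2 3 z + 3/2 * T / D z * s 3 6 z
    = 'D_(dv 5) (s 3 5) z - 1/4 * T * v z / B z * s 3 6 z.
  move=> Uz; rewrite -p3E//; eqn_ (5, 3, 5)%N Uz.
  by rewrite s33_eq0//; lra.
have d35 z : U z -> 'D_(dv 2) (s 3 5) z = - (1/4) / A z * s 3 5 z.
  by move=> Uz; eqn_ (2, 3, 5)%N Uz; lra.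
swapped 2%N 5%N (ss 3 5) Uy d35 h35.
differentiate 2%N H Uy; rewrite !eqn//; simplify_table.
rewrite p3E// s33_eq0// => h.
by apply: (@mulf_cancel0 ((A y)^-1 ^+ 2)); [neq0 Uy|lra].
Qed.

Lemma s36_eq0 y : U y -> s 3 6 y = 0.
Proof.
move=> Uy.
have H z : U z -> 'D_(dv 2) (s 2 6) z + (- (1/4) * u z / A z * s 3 6 z
      + 3/2 * T / D z * s 6 6 z)
    = 1/2 * 'D_(dv 6) (s 6 6) z - 3/2 / D z * s 3 6 z
      + 1/4 * T / B z * s 5 6 z + (w z / B z - 1/2 * T * v z / B z) * s 6 6 z.
  by move=> Uz; eqn_ (2, 2, 6)%N Uz; eqn_ (6, 6, 6)%N Uz; lra.
have d26 z : U z -> 'D_(dv 1) (s 2 6) z = 1/2 * s 3 6 z.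
  by move=> Uz; eqn_ (1, 2, 6)%N Uz; lra.
have d66 z : U z -> 'D_(dv 1) (s 6 6) z = 0.
  by move=> Uz; eqn_ (1, 6, 6)%N Uz; lra.
swapped 1%N 2%N (ss 2 6) Uy d26 h26.
swapped 1%N 6%N (ss 6 6) Uy d66 h66.
differentiate 1%N H Uy; rewrite !eqn//; simplify_table => h.
by apply: (@mulf_cancel0 (A y)^-1); [neq0 Uy|lra].
Qed.

Lemma p3_eq0 y : U y -> p 3 y = 0.
Proof. by move=> Uy; rewrite p3E// s23_eq0// s36_eq0// !mulr0 addr0. Qed.

Lemma s35_eq0 y : U y -> s 3 5 y = 0.
Proof.
move=> Uy.
have H z : U z -> 'D_(dv 2) (s 2 5) z + (- (1/4) * u z / A z * s 3 5 z
      + 3/2 * T / D z * s 5 6 z)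
    = 1/2 * 'D_(dv 5) (s 5 5) z - 3/2 / D z * s 3 5 z
      - 1/4 * T * v z / B z * s 5 6 z.
  by move=> Uz; eqn_ (2, 2, 5)%N Uz; eqn_ (5, 5, 5)%N Uz; lra.
have d25 z : U z -> 'D_(dv 1) (s 2 5) z = 1/2 * s 3 5 z.
  by move=> Uz; eqn_ (1, 2, 5)%N Uz; lra.
have d55 z : U z -> 'D_(dv 1) (s 5 5) z = 0.
  by move=> Uz; eqn_ (1, 5, 5)%N Uz; lra.
swapped 1%N 2%N (ss 2 5) Uy d25 h25.
swapped 1%N 5%N (ss 5 5) Uy d55 h55.
differentiate 1%N H Uy; rewrite !eqn//; simplify_table => h.
by apply: (@mulf_cancel0 (A y)^-1); [neq0 Uy|lra].
Qed.

Lemma s34_eq0 y : U y -> s 3 4 y = 0.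
Proof.
move=> Uy.
have H z : U z -> 'D_(dv 2) (s 2 4) z + (- (1/4) * u z / A z * s 3 4 z
      + 3/2 * T / D z * s 4 6 z + 3/4 * T * e^-1 / B z / D z * s 2 2 z)
    = 1/2 * 'D_(dv 4) (s 4 4) z - 3/2 / D z * s 3 4 z
      + 3/4 * T / B z * s 4 5 z + T * (3/4 * v z / B z + 9/2 / D z) * s 4 6 z.
  move=> Uz; eqn_ (2, 2, 4)%N Uz; eqn_ (4, 4, 4)%N Uz.
  by rewrite s23_eq0//; lra.
have d24 z : U z -> 'D_(dv 1) (s 2 4) z = 1/2 * s 3 4 z.
  by move=> Uz; eqn_ (1, 2, 4)%N Uz; rewrite s23_eq0//; lra.
have d44 z : U z -> 'D_(dv 1) (s 4 4) z
    = - 3 * T * e^-1 * A z / B z / D z * s 3 4 z.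
  by move=> Uz; eqn_ (1, 4, 4)%N Uz; lra.
swapped 1%N 2%N (ss 2 4) Uy d24 h24.
swapped 1%N 4%N (ss 4 4) Uy d44 h44.
differentiate 1%N H Uy; rewrite !eqn//; simplify_table.
rewrite p3_eq0// s33_eq0// s35_eq0// s36_eq0// s23_eq0// => h.
by apply: (@mulf_cancel0 (A y)^-1); [neq0 Uy|lra].
Qed.

Lemma p5E y : U y -> p 5 y = 1/4 / A y * s 2 5 y + 3/2 * T / D y * s 5 6 y.
Proof.
move=> Uy; eqn_ (3, 3, 5)%N Uy; rewrite (derive_eq0 _ s35_eq0 Uy).
by rewrite s35_eq0// s36_eq0//; lra.
Qed.

Lemma s25_eq0 y : U y -> s 2 5 y = 0.
Proof.
move=> Uy.
have H z : U z -> 1/4 / A z * s 2 5 z + 3/2 * T / D z * s 5 6 z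
    = 1/2 * 'D_(dv 5) (s 5 5) z - 1/4 * T * v z / B z * s 5 6 z.
  move=> Uz; rewrite -p5E//; eqn_ (5, 5, 5)%N Uz.
  by rewrite s35_eq0//; lra.
have d55 z : U z -> 'D_(dv 2) (s 5 5) z = 0.
  by move=> Uz; eqn_ (2, 5, 5)%N Uz; lra.
swapped 2%N 5%N (ss 5 5) Uy d55 h55.
differentiate 2%N H Uy; rewrite !eqn//; simplify_table.
rewrite p5E// s35_eq0// => h.
by apply: (@mulf_cancel0 ((A y)^-1 ^+ 2)); [neq0 Uy|lra].
Qed.

Lemma p6E y : U y -> p 6 y = 1/4 / A y * s 2 6 y + 3/2 * T / D y * s 6 6 y.
Proof.
move=> Uy; eqn_ (3, 3, 6)%N Uy; rewrite (derive_eq0 _ s36_eq0 Uy).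
by rewrite s36_eq0//; lra.
Qed.

Lemma s26_eq0 y : U y -> s 2 6 y = 0.
Proof.
move=> Uy.
have H z : U z -> 1/4 / A z * s 2 6 z + 3/2 * T / D z * s 6 6 z
    = 1/2 * 'D_(dv 6) (s 6 6) z
      + 1/4 * T / B z * s 5 6 z + (w z / B z - 1/2 * T * v z / B z) * s 6 6 z.
  move=> Uz; rewrite -p6E//; eqn_ (6, 6, 6)%N Uz.
  by rewrite s36_eq0//; lra.
have d66 z : U z -> 'D_(dv 2) (s 6 6) z = 0.
  by move=> Uz; eqn_ (2, 6, 6)%N Uz; lra.
swapped 2%N 6%N (ss 6 6) Uy d66 h66.
differentiate 2%N H Uy; rewrite !eqn//; simplify_table.
rewrite p6E// s36_eq0// => h.
by apply: (@mulf_cancel0 ((A y)^-1 ^+ 2)); [neq0 Uy|lra].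
Qed.

(* From here on only algebraic consequences of the equations remain, with
   s 2 2 and s 5 5 as basic unknowns. *)
Lemma p2_eq0 y : U y -> p 2 y = 0.
Proof.
move=> Uy; eqn_ (5, 2, 5)%N Uy; rewrite (derive_eq0 _ s25_eq0 Uy).
by rewrite s23_eq0// s26_eq0//; lra.
Qed.

(** The ratio is that of the entries (1,3) and (2,2) of the inverse metric; [s46E] is its
    counterpart in the second block. *)
Lemma s13E y : U y -> s 1 3 y = 1/2 / A y * s 2 2 y.
Proof.
move=> Uy; eqn_ (3, 2, 3)%N Uy; rewrite (derive_eq0 _ s23_eq0 Uy) p2_eq0//.
by rewrite s33_eq0// s23_eq0// s36_eq0// s26_eq0//; lra.
Qed.

Lemma p4E y : U y -> p 4 y = 1/4 / A y * s 2 4 y + 3/2 * T / D y * s 4 6 y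
  + 3/4 * T * e^-1 / B y / D y * s 2 2 y.
Proof.
move=> Uy; eqn_ (3, 3, 4)%N Uy; rewrite (derive_eq0 _ s34_eq0 Uy).
rewrite s33_eq0// s23_eq0// s34_eq0// s35_eq0// s36_eq0// s13E// => h.
transitivity (1/4 / A y * s 2 4 y + 3/2 * T / D y * s 4 6 y
  + 3/2 * T * e^-1 * A y / B y / D y * (1/2 / A y * s 2 2 y)); first by lra.
by field; neq0 Uy.
Qed.

Lemma s24_eq0 y : U y -> s 2 4 y = 0.
Proof.
move=> Uy.
have H z : U z -> 1/4 / A z * s 2 4 z + 3/2 * T / D z * s 4 6 z
      + 3/4 * T * e^-1 / B z / D z * s 2 2 z
    = 1/2 * 'D_(dv 4) (s 4 4) z
      + 3/4 * T / B z * s 4 5 z + T * (3/4 * v z / B z + 9/2 / D z) * s 4 6 z.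
  move=> Uz; rewrite -p4E//; eqn_ (4, 4, 4)%N Uz.
  by rewrite s34_eq0//; lra.
have d44 z : U z -> 'D_(dv 2) (s 4 4) z
    = - (3/2) * T * e^-1 / B z / D z * s 2 4 z.
  by move=> Uz; eqn_ (2, 4, 4)%N Uz; rewrite s34_eq0//; lra.
swapped 2%N 4%N (ss 4 4) Uy d44 h44.
differentiate 2%N H Uy; rewrite !eqn//; simplify_table.
rewrite p4E// p2_eq0// s34_eq0// s35_eq0// s36_eq0// s23_eq0// s25_eq0//.
rewrite s26_eq0// => h.
by apply: (@mulf_cancel0 ((A y)^-1 ^+ 2)); [neq0 Uy|lra].
Qed.

Lemma s16E y : U y -> s 1 6 y = 6 * T * A y / D y ^+ 2 * s 6 6 y.
Proof.
move=> Uy; eqn_ (3, 2, 6)%N Uy; rewrite (derive_eq0 _ s26_eq0 Uy).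
by rewrite s26_eq0// s36_eq0//; lra.
Qed.


(** [s16E] is differentiated along x^4: its right-hand side does not vary in that direction, while
    on the left the symbol Gamma^1_46 contributes a nonzero multiple of [s 6 6]. *)
Lemma s66_eq0 y : U y -> s 6 6 y = 0.
Proof.
move=> Uy; have := s16E => H.
have d66 : 'D_(dv 4) (s 6 6) y = 0 by eqn_ (4, 6, 6)%N Uy; lra.
have d16 : 'D_(dv 4) (s 1 6) y = 3/2 * e * B y / A y / D y * s 6 6 y.
  by eqn_ (4, 1, 6)%N Uy; lra.
differentiate 4%N H Uy; rewrite d66 d16 => h.
by apply: (@mulf_cancel0 (3/2 * e * B y / A y / D y)); [neq0 Uy|lra].
Qed.

Lemma s16_eq0 y : U y -> s 1 6 y = 0.
Proof. by move=> Uy; rewrite s16E// s66_eq0// mulr0. Qed.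

Lemma p6_eq0 y : U y -> p 6 y = 0.
Proof. by move=> Uy; rewrite p6E// s26_eq0// s66_eq0// !mulr0 addr0. Qed.

(** Since T may be 0, the equation (6; 6 6) gives only this product. It suffices for [s15_eq0],
    after which (5; 1 6) yields [s56_eq0] with a coefficient free of T. *)
Lemma Ts56_eq0 y : U y -> T * s 5 6 y = 0.
Proof.
move=> Uy; eqn_ (6, 6, 6)%N Uy; rewrite (derive_eq0 _ s66_eq0 Uy) p6_eq0//.
rewrite s36_eq0// s66_eq0// => h.
by apply: (@mulf_cancel0 (B y)^-1); [neq0 Uy|lra].
Qed.

Lemma s15_eq0 y : U y -> s 1 5 y = 0.
Proof.
move=> Uy; eqn_ (3, 2, 5)%N Uy; rewrite (derive_eq0 _ s25_eq0 Uy).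
rewrite s25_eq0// s35_eq0// s26_eq0// => h.
have -> : s 1 5 y = 6 * A y * (D y)^-1 ^+ 2 * (T * s 5 6 y) by lra.
by rewrite Ts56_eq0// mulr0.
Qed.

Lemma s56_eq0 y : U y -> s 5 6 y = 0.
Proof.
move=> Uy; eqn_ (5, 1, 6)%N Uy; rewrite (derive_eq0 _ s16_eq0 Uy).
rewrite s66_eq0// s36_eq0// s26_eq0// s15_eq0// s16_eq0// => h.
by apply: (@mulf_cancel0 (e / A y / D y)); [neq0 Uy|lra].
Qed.

Lemma p5_eq0 y : U y -> p 5 y = 0.
Proof. by move=> Uy; rewrite p5E// s25_eq0// s56_eq0// !mulr0 addr0. Qed.

(** [c] is the nonzero factor by which the goal, moved to one side, must be multiplied to become
    [h], up to sign. *)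
Ltac solve_linear h c Uy :=
  apply/eqP; rewrite -subr_eq0; apply/eqP; apply: (@mulf_cancel0 c);
  [by neq0 Uy | match type of h with ?lhs = ?rhs =>
     rewrite -[RHS](etrans (congr1 (fun z => rhs - z) h) (subrr rhs));
     by field; neq0 Uy end].

Ltac zeros Uy :=
  rewrite ?(s33_eq0 Uy) ?(s23_eq0 Uy) ?(s34_eq0 Uy) ?(s35_eq0 Uy) ?(s36_eq0 Uy)
    ?(s25_eq0 Uy) ?(s26_eq0 Uy) ?(s24_eq0 Uy) ?(s15_eq0 Uy) ?(s16_eq0 Uy)
    ?(s56_eq0 Uy) ?(s66_eq0 Uy) ?(p2_eq0 Uy) ?(p3_eq0 Uy) ?(p5_eq0 Uy)
    ?(p6_eq0 Uy).

(** Together with [p4E'] this shows that every component of p is a multiple of [s 2 2 + e * s 5 5],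
    which points to the first integral. *)
Lemma p1E y : U y ->
  p 1 y = - (3/4) / A y / D y * (e * s 5 5 y + s 2 2 y).
Proof.
move=> Uy; eqn_ (5, 1, 5)%N Uy; rewrite (derive_eq0 _ s15_eq0 Uy).
by zeros Uy; rewrite s13E//; lra.
Qed.

Lemma s46E y : U y -> s 4 6 y = 1/2 / B y * s 5 5 y.
Proof.
move=> Uy; eqn_ (6, 1, 6)%N Uy; rewrite (derive_eq0 _ s16_eq0 Uy).
zeros Uy; rewrite s13E// p1E// => h.
suff h' : s 5 5 y - 2 * B y * s 4 6 y = 0.
  have -> : s 5 5 y = 2 * B y * s 4 6 y by lra.
  by field; neq0 Uy.
by apply: (@mulf_cancel0 (e / A y / D y)); [neq0 Uy|lra].
Qed.

Lemma p4E' y : U y ->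
  p 4 y = 3/4 * T / B y / D y * (s 5 5 y + e^-1 * s 2 2 y).
Proof. by move=> Uy; rewrite p4E// s24_eq0// s46E//; lra. Qed.

Lemma d22 k y : (0 < k <= 6)%N -> U y -> 'D_(dv k) (s 2 2) y =
  match k with
  | 3%N => s 1 2 y + 1/2 * u y / A y * s 2 2 y
  | 6%N => - 3 * T / D y * s 2 2 y
  | _ => 0
  end.
Proof.
move: k => [|[|[|[|[|[|[|//]]]]]]]// _ Uy.
- by eqn_ (1, 2, 2)%N Uy; zeros Uy; lra.
- by eqn_ (2, 2, 2)%N Uy; zeros Uy; lra.
- by eqn_ (3, 2, 2)%N Uy; zeros Uy; lra.
- by eqn_ (4, 2, 2)%N Uy; zeros Uy; lra.
- by eqn_ (5, 2, 2)%N Uy; zeros Uy; lra.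
- by eqn_ (6, 2, 2)%N Uy; zeros Uy; lra.
Qed.

Lemma d55 k y : (0 < k <= 6)%N -> U y -> 'D_(dv k) (s 5 5) y =
  match k with
  | 3%N => 3 / D y * s 5 5 y
  | 6%N => T * s 4 5 y + 1/2 * T * v y / B y * s 5 5 y
  | _ => 0
  end.
Proof.
move: k => [|[|[|[|[|[|[|//]]]]]]]// _ Uy.
- by eqn_ (1, 5, 5)%N Uy; zeros Uy; lra.
- by eqn_ (2, 5, 5)%N Uy; zeros Uy; lra.
- by eqn_ (3, 5, 5)%N Uy; zeros Uy; lra.
- by eqn_ (4, 5, 5)%N Uy; zeros Uy; lra.
- by eqn_ (5, 5, 5)%N Uy; zeros Uy; lra.
- by eqn_ (6, 5, 5)%N Uy; zeros Uy; lra.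
Qed.

(** The x^3-derivative of [s13E], compared with the equation (3; 1 3); the terms in theta' cancel.
    [Ts45E] is the analogue along x^6, with the factor T kept. *)
Lemma s12E y : U y -> s 1 2 y = 3 / D y * s 2 2 y - 1/2 * u y / A y * s 2 2 y
  - 1 / D y * (e * s 5 5 y + s 2 2 y).
Proof.
move=> Uy; have := s13E => H.
differentiate 3%N H Uy; rewrite d22//=.
eqn_ (3, 1, 3)%N Uy => ->; zeros Uy; rewrite s13E// p1E// => h.
apply/eqP; rewrite -subr_eq0; apply/eqP.
by apply: (@mulf_cancel0 (A y)^-1); [neq0 Uy|lra].
Qed.

Lemma Ts45E y : U y -> T * s 4 5 y =
  T * (1 / D y * (s 5 5 y + e^-1 * s 2 2 y) - 1/2 * v y / B y * s 5 5 y
       - 3 / D y * s 5 5 y).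
Proof.
move=> Uy; have := s46E => H.
differentiate 6%N H Uy; rewrite d55//=.
eqn_ (6, 4, 6)%N Uy => ->; zeros Uy; rewrite s46E// p4E'// => h.
apply/eqP; rewrite -subr_eq0; apply/eqP.
by apply: (@mulf_cancel0 (B y)^-1); [neq0 Uy|lra].
Qed.


(** The exponent: S = [s 2 2 + e * s 5 5] has derivatives 2 S / D along x^3 and - 2 T S / D along
    x^6, where D has derivatives -1 and T. *)
Lemma first_integral k y : (0 < k <= 6)%N -> U y ->
  is_derive y (dv k) (fun z => D z ^+ 2 * (s 2 2 z + e * s 5 5 z)) 0.
Proof.
move=> hk Uy; eapply is_derive_eq; first by der Uy.
rewrite d22// d55//; move: k hk => [|[|[|[|[|[|[|//]]]]]]]//= _.
- by lra.
- by lra.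
- by rewrite s12E//; field; neq0 Uy.
- by lra.
- by lra.
- by rewrite Ts45E//; field; neq0 Uy.
Qed.

(** * Solutions with vanishing first integral *)

Section Trivial.
Hypothesis int0 : forall y, U y -> s 2 2 y + e * s 5 5 y = 0.

Lemma s22E y : U y -> s 2 2 y = - e * s 5 5 y.
Proof. by move=> Uy; have := int0 Uy; lra. Qed.

Lemma s12E' y : U y -> s 1 2 y = (3 / D y - 1/2 * u y / A y) * s 2 2 y.
Proof.
by move=> Uy; have h := int0 Uy; rewrite s12E// [e * _ + _]addrC h; lra.
Qed.

Lemma p_eq0 i y : (0 < i <= 6)%N -> U y -> p i y = 0.
Proof.
move: i => [|[|[|[|[|[|[|//]]]]]]]// _ Uy.
- by rewrite p1E// [e * _ + _]addrC int0// mulr0.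
- by zeros Uy.
- by zeros Uy.
- by rewrite p4E'// s22E//; field; neq0 Uy.
- by zeros Uy.
- by zeros Uy.
Qed.

Lemma s14_eq0 y : U y -> s 1 4 y = 0.
Proof.
move=> Uy; eqn_ (3, 2, 4)%N Uy; rewrite (derive_eq0 _ s24_eq0 Uy).
zeros Uy; rewrite s12E'// s46E// s22E// => h.
solve_linear h (1/2 : R) Uy.
Qed.

(** Here and in [s44E] the unknown enters through Gamma^1_64, whose coefficient belongs to the first
    block, so the case T = 0 is covered. *)
Lemma s45E y : U y -> s 4 5 y = - (1/2 * v y / B y + 3 / D y) * s 5 5 y.
Proof.
move=> Uy; eqn_ (6, 1, 5)%N Uy; rewrite (derive_eq0 _ s15_eq0 Uy).
zeros Uy; rewrite s14_eq0// s13E// s22E// => h.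
solve_linear h (3/2 * e * B y / A y / D y) Uy.
Qed.

Lemma s44E y : U y -> s 4 4 y = 6 / D y ^+ 2 * s 5 5 y.
Proof.
move=> Uy; eqn_ (6, 1, 4)%N Uy; rewrite (derive_eq0 _ s14_eq0 Uy).
zeros Uy; rewrite s14_eq0// s13E// s22E// s45E// s46E// => h.
solve_linear h (3/2 * e * B y / A y / D y) Uy.
Qed.

Lemma s11E y : U y -> s 1 1 y = 6 / D y ^+ 2 * s 2 2 y.
Proof.
move=> Uy; have H := s12E'.
differentiate 3%N H Uy; rewrite d22//=.
eqn_ (3, 1, 2)%N Uy => ->; zeros Uy; by rewrite s13E// s12E'//; lra.
Qed.

(** The function is the quotient of s by the inverse metric, read off at the entry (2,2) for c =
    1. *)
Lemma conformal_factor k y : (0 < k <= 6)%N -> U y ->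
  is_derive y (dv k) (fun z => D z ^+ 3 * s 2 2 z) 0.
Proof.
move=> hk Uy; eapply is_derive_eq; first by der Uy.
rewrite d22//; move: k hk => [|[|[|[|[|[|[|//]]]]]]]//= _.
- by lra.
- by lra.
- by rewrite s12E'//; field; neq0 Uy.
- by lra.
- by lra.
- by field; neq0 Uy.
Qed.

(** The constants [1] and [e^-1] are [c^-1] and [c'^-1] multiplied by [c], for e = c' / c. *)
Lemma s_ginv i j y : (0 < i <= j)%N -> (j <= 6)%N -> U y -> s i j y =
  D y ^+ 3 * s 2 2 y *
  ginv_table 1 e^-1 (A y)^-1 (B y)^-1 (D y)^-1 (u y) (v y) i j.
Proof.
move=> + + Uy; rewrite /ginv_table /ginv_block.
move: i => [|[|[|[|[|[|[|i]]]]]]]//; move: j => [|[|[|[|[|[|[|j]]]]]]]// _ _ /=;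
  zeros Uy; rewrite ?s14_eq0// ?mulr0//;
  rewrite ?(s13E, s12E', s45E, s44E, s46E, s11E)// ?s22E//; by field; neq0 Uy.
Qed.

End Trivial.

End TwoBlockSystem.

(** * From the component system back to tensors *)

Section Frame.
Variables (R : realType) (U : set 'rV[R]_6) (nu : nat -> nat).
Hypotheses (openU : open U) (connectedU : connected U).
Variables (A B D u v t w : 'rV[R]_6 -> R) (c c' T : R).
Variables (g G : 'rV[R]_6 -> 'M[R]_6).

(* [nu] is the identity or the exchange of the two blocks. *)
Definition axis (k : nat) : 'rV[R]_6 := delta_mx ord0 (idx (nu k)).

Hypotheses (sD : smooth_on U D) (c0 : c != 0) (c'0 : c' != 0)
  (A0 : forall y, U y -> A y != 0)
  (B0 : forall y, U y -> B y != 0) (D0 : forall y, U y -> D y != 0).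
Hypotheses (dA : derives U axis A (fun k y => grad_A 1 (t y) k))
  (dB : derives U axis B (fun k y => grad_B T (w y) k))
  (dD : derives U axis D (fun k y => grad_D 1 T k))
  (du : derives U axis u (fun k y => grad_u 1 k))
  (dv : derives U axis v (fun k y => grad_v T k))
  (dw : forall k y, U y -> k = 1%N \/ k = 2%N -> is_derive y (axis k) w 0).
Hypotheses (gT : forall y, (g y)^T = g y)
  (gG : forall y, U y -> g y *m G y = 1%:M)
  (sg : smooth_mx U g) (sG : smooth_mx U G).
Hypothesis gammaE : forall i j k y, (0 < i <= 6)%N -> (0 < j <= 6)%N ->
  (0 < k <= 6)%N -> U y ->
  christoffel g (idx (nu i)) (idx (nu j)) (idx (nu k)) y =
  gam A B D u v t w (c' / c) T y i j k.
Hypothesis ginvE : forall i j y, (0 < i <= 6)%N -> (0 < j <= 6)%N -> U y ->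
  G y (idx (nu i)) (idx (nu j)) =
  ginv_table c^-1 c'^-1 (A y)^-1 (B y)^-1 (D y)^-1 (u y) (v y) i j.
Hypotheses (nu_sum : forall F : 'I_6 -> R,
    \sum_l F l = sum6 (fun l => F (idx (nu l))))
  (nu_surj : forall i : 'I_6, exists2 m, (0 < m <= 6)%N & i = idx (nu m))
  (nu_inj : forall i j, (0 < i <= 6)%N -> (0 < j <= 6)%N ->
    (idx (nu i) == idx (nu j)) = Nat.eqb i j).

Definition block_integral (b : 'M[R]_6) x : R := D x ^+ 2 *
  ((G x *m b *m G x) (idx (nu 2)) (idx (nu 2))
   + c' / c * (G x *m b *m G x) (idx (nu 5)) (idx (nu 5))).

Variables (b : 'rV[R]_6 -> 'M[R]_6) (phi : 'rV[R]_6 -> R).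
Hypotheses (bT : forall y, (b y)^T = b y) (sb : smooth_mx U b).
Hypothesis sphi : smooth_on U phi.
Hypothesis eisenhart : forall x, U x -> forall i j k : 'I_6,
  cov_deriv g b i j k x = 2 * g x i j * partial k phi x
    + g x i k * partial j phi x + g x j k * partial i phi x.

Definition frame_s i j y : R := contra g G b phi y (idx (nu i)) (idx (nu j)).
Definition frame_p i y : R := contra_grad G phi (idx (nu i)) y.

Let e0 : c' / c != 0. Proof. by rewrite mulf_neq0 ?invr_neq0. Qed.

Lemma Gsym y : U y -> (G y)^T = G y.
Proof.
move=> Uy; rewrite -[LHS]mulmx1 -(gG Uy) mulmxA -{1}gT -trmx_mul gG//.
by rewrite trmx1 mul1mx.
Qed.

Lemma contraE y : U y ->
  contra g G b phi y = G y *m b y *m G y - (2 * phi y) *: G y.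
Proof.
move=> Uy; rewrite /contra mulmxBr mulmxBl -scalemxAr -scalemxAl.
by rewrite -[X in _ - _ *: X]mulmxA gG// mulmx1.
Qed.

Lemma frame_s_sym i j y : U y -> frame_s i j y = frame_s j i y.
Proof.
move=> Uy; rewrite /frame_s.
suff h : (contra g G b phi y)^T = contra g G b phi y by rewrite -{1}h mxE.
by rewrite /contra !trmx_mul linearB linearZ /= bT gT Gsym// mulmxA.
Qed.

Lemma smooth_frame_s i j : smooth_on U (frame_s i j).
Proof.
have h := smooth_contra openU sg sG sb sphi.
exact: (h (idx (nu i)) (idx (nu j))).
Qed.

Lemma frame_eqn k i j y : (0 < k <= 6)%N -> (0 < i <= 6)%N ->
  (0 < j <= 6)%N -> U y -> 'D_(axis k) (frame_s i j) y =
  eisenhart_rhs A B D u v t w (c' / c) T frame_s frame_p k i j y.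
Proof.
move=> hk hi hj Uy.
rewrite [LHS](contra_eisenhart openU gT gG sg sG sb sphi eisenhart) //.
rewrite !nu_inj// /eisenhart_rhs; congr (_ + _ - _).
- by case: Nat.eqb; rewrite ?mul1r ?mul0r.
- by case: Nat.eqb; rewrite ?mul1r ?mul0r.
have usymE m m' : usym frame_s m m' y = frame_s m m' y.
  by rewrite /usym; case: Nat.leb => //; exact: frame_s_sym.
rewrite nu_sum /sum6 !usymE.
by rewrite !gammaE.
Qed.

(** The entries (2,2) and (5,5) of the inverse metric are [c^-1] / D^3 and - [c'^-1] / D^3, so the
    term in phi cancels. Hence [block_integral] can be defined from [b] alone and is linear,
    although phi is only known to exist for each field. *)
Lemma block_integralE y : U y ->
  block_integral (b y) y = D y ^+ 2 * (frame_s 2 2 y + c' / c * frame_s 5 5 y).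
Proof.
move=> Uy; rewrite /block_integral /frame_s contraE// !(mxE, ginvE)//=.
by congr (_ * _); field; rewrite c0 c'0 D0.
Qed.

Lemma axis_const (f : 'rV[R]_6 -> R) : smooth_on U f ->
  (forall k y, (0 < k <= 6)%N -> U y -> is_derive y (axis k) f 0) ->
  forall x y, U x -> U y -> f x = f y.
Proof.
move=> sf f0 x y Ux Uy; have df z : U z -> differentiable f z.
  exact: smooth_differentiable sf.
apply: (connected_constant openU) => // z z' Uz.
rewrite derive_partial; last exact: df.
rewrite big1// => i _; have [m hm ->] := nu_surj i.
by rewrite /partial; have [_ ->] := f0 m z hm Uz; rewrite mulr0.
Qed.

Lemma conformal_of_integral x0 : U x0 -> block_integral (b x0) x0 = 0 ->
  exists k, forall x, U x -> b x = k *: g x.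
Proof.
move=> Ux0 F0.
have ss := smooth_frame_s.
have first y : U y -> frame_s 2 2 y + c' / c * frame_s 5 5 y = 0.
  move=> Uy; apply: (@mulf_cancel0 _ (D y ^+ 2)); first by rewrite expf_neq0 ?D0.
  rewrite -F0 block_integralE//.
  apply: (axis_const (f := fun z => D z ^+ 2 *
    (frame_s 2 2 z + c' / c * frame_s 5 5 z))) => // [|k z hk Uz].
    apply: smoothM => //; first exact: smoothX.
    by apply: smoothD => //; apply: smoothM => //; exact: smooth_cst.
  exact: (first_integral openU A0 B0 D0 e0 ss dA dB dD du dv dw frame_eqn).
have p0 i y : (0 < i <= 6)%N -> U y -> frame_p i y = 0.
  exact: (p_eq0 openU A0 B0 D0 e0 ss dA dB dD du dv dw frame_eqn first).
(* The vector p is [G] applied to the differential of phi, and [G] is invertible. *)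
have phi0 i y : U y -> partial i phi y = 0.
  move=> Uy; pose dphi : 'cV[R]_6 := \col_l partial l phi y.
  suff : dphi = 0 by move/matrixP/(_ i ord0); rewrite !mxE.
  rewrite -[LHS]mul1mx -(gG Uy) -mulmxA.
  have -> : G y *m dphi = 0.
    apply/matrixP => l j; rewrite !mxE; have [m hm ->] := nu_surj l.
    rewrite -[RHS](p0 m y hm Uy); apply: eq_bigr => q _.
    by rewrite mxE.
  by rewrite mulmx0.
(* The first term undoes the subtraction of 2 phi g in [contra]; the second is the factor of s over
   [G], with the [c] dropped in [s_ginv] restored. *)
pose psi y := 2 * phi y + c * (D y ^+ 3 * frame_s 2 2 y).
have psiE y : U y -> b y = psi y *: g y.
  move=> Uy.
  have sE : contra g G b phi y = (c * (D y ^+ 3 * frame_s 2 2 y)) *: G y.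
    apply/matrixP => i j; rewrite [RHS]mxE.
    have [m hm ->] := nu_surj i; have [q hq ->] := nu_surj j.
    have main m' q' : (0 < m' <= 6)%N -> (0 < q' <= 6)%N -> (m' <= q')%N ->
      frame_s m' q' y = c * (D y ^+ 3 * frame_s 2 2 y) *
        G y (idx (nu m')) (idx (nu q')).
      move=> hm' hq' mq.
      rewrite (s_ginv openU A0 B0 D0 e0 ss dA dB dD du dv dw frame_eqn first) //.
      - rewrite ginvE// /ginv_table /ginv_block.
        case/andP: hm' => _; case/andP: hq' => _.
        move: (frame_s 2 2 y) => S.
        move: m' {mq} => [|[|[|[|[|[|[|m']]]]]]]// + _;
        move: q' => [|[|[|[|[|[|[|q']]]]]]]//= _ ;
        by field; rewrite ?c0 ?c'0 ?A0 ?B0 ?D0.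
      - by case/andP: hm' => ->.
      - by case/andP: hq'.
    case/orP: (leq_total m q) => h; first exact: main.
    rewrite -[LHS]/(frame_s m q y) frame_s_sym// main//.
    by rewrite -{1}(Gsym Uy) mxE.
  have := contraE Uy; rewrite sE => /eqP; rewrite eq_sym subr_eq -scalerDl.
  rewrite [_ + 2 * _]addrC -/(psi y) => /eqP h.
  rewrite -[LHS]mul1mx -[LHS]mulmx1 -{1}(gG Uy) -(mulmx1C (gG Uy)) !mulmxA.
  rewrite -[g y *m G y *m b y *m G y]mulmxA -[g y *m G y *m _]mulmxA.
  by rewrite [G y *m (b y *m _)]mulmxA h -scalemxAr -scalemxAl gG// mul1mx.
exists (psi x0) => x Ux; rewrite psiE//; congr (_ *: _).
apply: axis_const => // [|k y hk Uy].
  apply: smoothD => //; apply: smoothM => //; first exact: smooth_cst.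
    exact: smooth_cst.
  by apply: smoothM => //; exact: smoothX.
have dphi : is_derive y (axis k) phi 0.
  by rewrite -(phi0 (idx (nu k)) y Uy); exact: smooth_is_derive sphi Uy.
have dpsi := conformal_factor openU A0 B0 D0 e0 ss dA dB dD du dv dw frame_eqn
  first hk Uy.
have := derive_fD (derive_fM (derive_fcst y (axis k) 2) dphi)
  (derive_fM (derive_fcst y (axis k) c) dpsi).
by rewrite !mulr0 !addr0.
Qed.

End Frame.

(** * The h-space *)

Section HSpace.
Variables (R : realType) (d : h33_data R).
Local Notation point := 'rV[R]_6.
Implicit Types (x y : point) (i j k : nat).

Definition gap x : R := f6 d x - f3 d x.
Definition nil3 x : R := eps d * Defs.coord 1 x.
Definition nil6 x : R := epst d * Defs.coord 4 x.
Definition dtheta x : R := 'D_(1 : R) (theta d) (Defs.coord 3 x).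
Definition domega x : R := 'D_(1 : R) (omega d) (Defs.coord 6 x).

Definition gram x : nat -> nat -> R :=
  gram_table (e3 d) (e6 d) (A d x) (At d x) (gap x) (nil3 x) (nil6 x).

Definition inv_metric x : 'M[R]_6 := \matrix_(i, j)
  ginv_table (e3 d)^-1 (e6 d)^-1 (A d x)^-1 (At d x)^-1 (gap x)^-1
    (nil3 x) (nil6 x) i.+1 j.+1.

Lemma idxK (i : 'I_6) : idx i.+1 = i.
Proof. by apply/val_inj; rewrite /= modn_small. Qed.

Lemma sum_ord6 (F : 'I_6 -> R) : \sum_l F l = sum6 (fun l => F (idx l)).
Proof.
rewrite !big_ord_recr big_ord0 /= add0r /sum6.
by congr (_ + _ + _ + _ + _ + _); congr F; apply/val_inj.
Qed.

Lemma ord6P (P : 'I_6 -> Prop) :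
  (forall k, (0 < k <= 6)%N -> P (idx k)) -> forall i : 'I_6, P i.
Proof. by move=> h i; rewrite -(idxK i); apply: h => /=. Qed.

Lemma idx_eq i j : (0 < i <= 6)%N -> (0 < j <= 6)%N ->
  (idx i == idx j) = (i == j).
Proof.
move: i j => [|i] [|j]//= hi hj.
by rewrite -val_eqE /= !modn_small.
Qed.

Lemma dxdxE a b i j : (0 < a <= 6)%N -> (0 < b <= 6)%N -> (0 < i <= 6)%N ->
  (0 < j <= 6)%N -> dxdx R a b (idx i) (idx j) =
  2^-1 * (((i == a) && (j == b))%:R + ((i == b) && (j == a))%:R).
Proof. by move=> ha hb hi hj; rewrite !mxE !idx_eq. Qed.

Lemma h33_metricE i j x : (0 < i <= 6)%N -> (0 < j <= 6)%N ->
  h33_metric d x (idx i) (idx j) = gram x i j.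
Proof.
move=> hi hj; rewrite /gram /h33_metric.
have fE : f3 d x - f6 d x = - gap x by rewrite opprB.
rewrite /Sigma1 /Sigma2 fE -/(gap x) -/(nil3 x) -/(nil6 x).
have dE p q hp hq := @dxdxE p q i j hp hq hi hj.
move: (dxdx R) dE => X dE.
have addE (M N : 'M[R]_6) p q : (M + N) p q = M p q + N p q by rewrite mxE.
have scaleE (z : R) (M : 'M[R]_6) p q : (z *: M) p q = z * M p q.
  by rewrite mxE.
rewrite !(addE, scaleE) !dE// {dE}.
move: (gap x) (A d x) (At d x) (nil3 x) (nil6 x) => D a b u v.
(* The identity is used on the whole coordinate space. Where D = 0 the inverses in [Sigma1] and
   [Sigma2] are 0 by convention, and the factor D^3 makes both sides vanish. *)
have [->|D0] := eqVneq D 0.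
  rewrite oppr0 !expr0n /= !mulr0 !mul0r addr0 /gram_table /gram_block.
  move: i hi => [|[|[|[|[|[|[|//]]]]]]]// _;
  by move: j hj => [|[|[|[|[|[|[|//]]]]]]]// _ /=; ring.
rewrite /gram_table /gram_block.
move: i hi => [|[|[|[|[|[|[|//]]]]]]]// _;
by move: j hj => [|[|[|[|[|[|[|//]]]]]]]// _ /=; field.
Qed.

Lemma h33_metric_sym x : (h33_metric d x)^T = h33_metric d x.
Proof.
apply/matrixP => i j; rewrite [LHS]mxE.
elim/ord6P: i => i hi; elim/ord6P: j => j hj.
rewrite !h33_metricE// /gram /gram_table /gram_block.
move: i hi => [|[|[|[|[|[|[|//]]]]]]]// _;
by move: j hj => [|[|[|[|[|[|[|//]]]]]]]// _.
Qed.

Section OnDomain.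
Variable U : set point.
Hypothesis hU : h33_space d U.

Lemma h33_open : open U. Proof. by have [[]] := hU. Qed.

Lemma h33_connected : connected U. Proof. by have [[]] := hU. Qed.

Lemma h33_sign : e3 d != 0 /\ e6 d != 0.
Proof.
have [_ [[h3 h6 _ _] _]] := hU.
by split; [case: h3 => ->|case: h6 => ->]; rewrite ?oppr_eq0 oner_eq0.
Qed.

Lemma h33_unit x : U x -> h33_metric d x \in unitmx.
Proof.
move=> Ux; have [_ [_ [_ /(_ x Ux) [_ [P Pu PE]]]]] := hU.
have : P^T *m h33_metric d x *m P \in unitmx.
  rewrite PE unitmxE det_diag unitfE; apply/prodf_neq0 => i _.
  by rewrite mxE; case: ifP; rewrite ?oppr_eq0 oner_eq0.
by rewrite !unitmx_mul => /andP[/andP[_ ->]].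
Qed.

Lemma unitmx_row_neq0 (M : 'M[R]_6) (i : 'I_6) : M \in unitmx -> row i M != 0.
Proof.
move=> Mu; apply/eqP => M0; have : row i (1%:M : 'M[R]_6) = 0.
  by rewrite -(mulmxV Mu) row_mul M0 mul0mx.
by move/matrixP/(_ ord0 i); rewrite !mxE eqxx => /eqP; rewrite oner_eq0.
Qed.

(** Row 1 of the Gram matrix has the single nonzero candidate 2 e3 A D^3, and row 4 has its
    counterpart; nondegeneracy thus forces A, [At] and the gap to be nonzero on [U]. *)
Lemma h33_row k x : (0 < k <= 6)%N -> U x ->
  ~ (forall l, (0 < l <= 6)%N -> gram x k l = 0).
Proof.
move=> hk Ux h; have /eqP[] := unitmx_row_neq0 (idx k) (h33_unit Ux).
apply/matrixP => i j; rewrite [LHS]mxE [RHS]mxE; elim/ord6P: j => l hl.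
by rewrite h33_metricE// h.
Qed.

Lemma gap_neq0 x : U x -> gap x != 0.
Proof.
move=> Ux; apply/eqP => D0; apply: (@h33_row 1 x) => // l hl.
rewrite /gram D0 /gram_table /gram_block.
by move: l hl => [|[|[|[|[|[|[|//]]]]]]]// _; rewrite expr0n mulr0.
Qed.

Lemma A_neq0 x : U x -> A d x != 0.
Proof.
move=> Ux; apply/eqP => D0; apply: (@h33_row 1 x) => // l hl.
rewrite /gram D0 /gram_table /gram_block.
by move: l hl => [|[|[|[|[|[|[|//]]]]]]]// _; rewrite mulr0 mul0r.
Qed.

Lemma At_neq0 x : U x -> At d x != 0.
Proof.
move=> Ux; apply/eqP => D0; apply: (@h33_row 4 x) => // l hl.
rewrite /gram D0 /gram_table /gram_block.
by move: l hl => [|[|[|[|[|[|[|//]]]]]]]// _; rewrite /= mulr0 mul0r.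
Qed.

Lemma metric_inv x : U x -> h33_metric d x *m inv_metric x = 1%:M.
Proof.
move=> Ux; have [c0 c'0] := h33_sign.
apply/matrixP => i j; elim/ord6P: i => i hi; elim/ord6P: j => j hj.
rewrite [LHS]mxE sum_ord6 [RHS]mxE idx_eq//.
rewrite -(gram_ginv (nil3 x) (nil6 x) c0 c'0 (A_neq0 Ux) (At_neq0 Ux)
  (gap_neq0 Ux) hi hj).
have hj' : (val (idx j)).+1 = j.
  by case: j hj => // j hj; rewrite /= modn_small.
by rewrite /sum6 !h33_metricE// ![inv_metric x _ _]mxE hj'.
Qed.

Lemma smooth_coordinate k : smooth_on U (Defs.coord k : point -> R).
Proof. exact: smooth_coord h33_open _. Qed.

Lemma smooth_theta : smooth_on U (fun x => theta d (Defs.coord 3 x)).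
Proof.
have [_ [_ [[_ h _ _ _] _]]] := hU.
exact: (smooth_comp_coord h33_open (i := idx 3) h).
Qed.

Lemma smooth_omega : smooth_on U (fun x => omega d (Defs.coord 6 x)).
Proof.
have [_ [_ [[_ _ h _ _] _]]] := hU.
exact: (smooth_comp_coord h33_open (i := idx 6) h).
Qed.

Lemma smooth_scaled (c : R) (f : point -> R) : smooth_on U f ->
  smooth_on U (fun x => c * f x).
Proof.
move=> sf; apply: smoothM => //; first exact: h33_open.
exact: smooth_cst h33_open _.
Qed.

Lemma smooth_nil3 : smooth_on U nil3.
Proof. exact: smooth_scaled (smooth_coordinate 1). Qed.

Lemma smooth_nil6 : smooth_on U nil6.
Proof. exact: smooth_scaled (smooth_coordinate 4). Qed.

Lemma smooth_A : smooth_on U (A d).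
Proof.
apply: (smoothD h33_open) smooth_theta.
exact: smooth_scaled (smooth_coordinate 2).
Qed.

Lemma smooth_At : smooth_on U (At d).
Proof.
apply: (smoothD h33_open) smooth_omega.
exact: smooth_scaled (smooth_coordinate 5).
Qed.

Lemma smooth_gap : smooth_on U gap.
Proof.
apply: (smoothB h33_open); last exact: smooth_scaled (smooth_coordinate 3).
apply: (smoothD h33_open); first exact: smooth_scaled (smooth_coordinate 6).
exact: smooth_cst h33_open _.
Qed.

Ltac smoothness :=
  repeat first
  [ exact (smooth_cst h33_open _)
  | exact smooth_A | exact smooth_At | exact smooth_gap
  | exact smooth_nil3 | exact smooth_nil6
  | exact (smoothV h33_open A_neq0 smooth_A)
  | exact (smoothV h33_open At_neq0 smooth_At)
  | exact (smoothV h33_open gap_neq0 smooth_gap)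
  | apply (smoothD h33_open) | apply (smoothN h33_open)
  | apply (smoothX h33_open) | apply (smoothM h33_open) ].

Lemma smooth_inv_metric : smooth_mx U inv_metric.
Proof.
move=> i j; under eq_fun do rewrite mxE.
elim/ord6P: i => i hi; elim/ord6P: j => j hj.
have hi' : (val (idx i)).+1 = i.
  by case: i hi => // i hi; rewrite /= modn_small.
have hj' : (val (idx j)).+1 = j.
  by case: j hj => // j hj; rewrite /= modn_small.
rewrite hi' hj' /ginv_table /ginv_block {hi' hj'}.
move: i hi => [|[|[|[|[|[|[|//]]]]]]]// _;
by move: j hj => [|[|[|[|[|[|[|//]]]]]]]// _ /=; smoothness.
Qed.

Lemma smooth_h33_metric : smooth_mx U (h33_metric d).
Proof.
move=> i j; elim/ord6P: i => i hi; elim/ord6P: j => j hj.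
under eq_fun do rewrite h33_metricE// /gram /gram_table /gram_block.
move: i hi => [|[|[|[|[|[|[|//]]]]]]]// _;
by move: j hj => [|[|[|[|[|[|[|//]]]]]]]// _ /=; smoothness.
Qed.

End OnDomain.

End HSpace.

(** * The Levi-Civita connection of the metric *)

Section HSpaceConnection.
Variables (R : realType) (d : h33_data R) (U : set 'rV[R]_6).
Hypothesis hU : h33_space d U.
Local Notation point := 'rV[R]_6.
Local Notation g := (h33_metric d).
Local Notation ax := (axis R (fun k => k)).
Implicit Types (x y : point) (i j k l : nat).

Lemma derive_coordinate k l x : (0 < k <= 6)%N -> (0 < l <= 6)%N ->
  is_derive x (ax k) (Defs.coord l : point -> R) (l == k)%:R.
Proof.
move=> hk hl; have := derive_coord (idx l) x (ax k).
by rewrite [X in is_derive _ _ _ X]mxE eqxx /= idx_eq.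
Qed.

Lemma derive_of_coordinate (h : R -> R) k l x : (0 < k <= 6)%N ->
  (0 < l <= 6)%N -> smooth_on U (fun y => h (Defs.coord l y)) -> U x ->
  is_derive x (ax k) (fun y => h (Defs.coord l y))
    (if l == k then 'D_(1 : R) h (Defs.coord l x) else 0).
Proof.
move=> hk hl sh Ux; have := smooth_is_derive (ax k) sh Ux.
rewrite [X in is_derive _ _ _ X](derive_comp_coord h (idx l)).
rewrite [(ax k) _ _]mxE eqxx /= idx_eq//.
by case: eqP => // _; rewrite derive0.
Qed.

Lemma derives_A : derives U ax (A d) (fun k y => grad_A (eps d) (dtheta d y) k).
Proof.
move=> k y hk Uy; have h1 := derive_coordinate y hk (isT : 0 < 2 <= 6)%N.
have h2 := derive_of_coordinate hk (isT : 0 < 3 <= 6)%N (smooth_theta hU) Uy.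
have := derive_fD (derive_fM (derive_fcst y (ax k) (eps d)) h1) h2.
rewrite mulr0 addr0.
move: k hk {h1 h2} => [|[|[|[|[|[|[|//]]]]]]]// _ /=;
  by rewrite ?mulr0 ?mulr1 ?addr0 ?add0r.
Qed.

Lemma derives_At :
  derives U ax (At d) (fun k y => grad_B (epst d) (domega d y) k).
Proof.
move=> k y hk Uy; have h1 := derive_coordinate y hk (isT : 0 < 5 <= 6)%N.
have h2 := derive_of_coordinate hk (isT : 0 < 6 <= 6)%N (smooth_omega hU) Uy.
have := derive_fD (derive_fM (derive_fcst y (ax k) (epst d)) h1) h2.
rewrite mulr0 addr0.
move: k hk {h1 h2} => [|[|[|[|[|[|[|//]]]]]]]// _ /=;
  by rewrite ?mulr0 ?mulr1 ?addr0 ?add0r.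
Qed.

Lemma derives_gap : derives U ax (gap d) (fun k y => grad_D (eps d) (epst d) k).
Proof.
move=> k y hk Uy; have h3 := derive_coordinate y hk (isT : 0 < 3 <= 6)%N.
have h6 := derive_coordinate y hk (isT : 0 < 6 <= 6)%N.
have := derive_fD (derive_fD (derive_fM (derive_fcst y (ax k) (epst d)) h6)
  (derive_fcst y (ax k) (Defs.cst d)))
  (derive_fN (derive_fM (derive_fcst y (ax k) (eps d)) h3)).
rewrite !mulr0 !addr0.
move: k hk {h3 h6} => [|[|[|[|[|[|[|//]]]]]]]// _ /=;
  by rewrite ?mulr0 ?mulr1 ?oppr0 ?addr0 ?add0r.
Qed.

Lemma derives_nil3 : derives U ax (nil3 d) (fun k y => grad_u (eps d) k).
Proof.
move=> k y hk Uy; have h1 := derive_coordinate y hk (isT : 0 < 1 <= 6)%N.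
have := derive_fM (derive_fcst y (ax k) (eps d)) h1.
rewrite mulr0 addr0.
by move: k hk {h1} => [|[|[|[|[|[|[|//]]]]]]]// _ /=; rewrite ?mulr0 ?mulr1.
Qed.

Lemma derives_nil6 : derives U ax (nil6 d) (fun k y => grad_v (epst d) k).
Proof.
move=> k y hk Uy; have h1 := derive_coordinate y hk (isT : 0 < 4 <= 6)%N.
have := derive_fM (derive_fcst y (ax k) (epst d)) h1.
rewrite mulr0 addr0.
by move: k hk {h1} => [|[|[|[|[|[|[|//]]]]]]]// _ /=; rewrite ?mulr0 ?mulr1.
Qed.

Lemma smooth_dtheta : smooth_on U (dtheta d).
Proof.
have [_ [_ [[_ h _ _ _] _]]] := hU.
apply: (smooth_comp_coord (h33_open hU) (i := idx 3) (h := 'D_(1 : R) (theta d))).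
exact: smooth_derive h.
Qed.

Lemma smooth_domega : smooth_on U (domega d).
Proof.
have [_ [_ [[_ _ h _ _] _]]] := hU.
apply: (smooth_comp_coord (h33_open hU) (i := idx 6) (h := 'D_(1 : R) (omega d))).
exact: smooth_derive h.
Qed.

Lemma derive_dtheta k y : (0 < k <= 6)%N -> k != 3%N -> U y ->
  is_derive y (ax k) (dtheta d) 0.
Proof.
move=> hk k3 Uy.
have := derive_of_coordinate (h := 'D_(1 : R) (theta d)) hk
  (isT : 0 < 3 <= 6)%N smooth_dtheta Uy.
by rewrite eq_sym (negbTE k3).
Qed.

Lemma derive_domega k y : (0 < k <= 6)%N -> k != 6%N -> U y ->
  is_derive y (ax k) (domega d) 0.
Proof.
move=> hk k3 Uy.
have := derive_of_coordinate (h := 'D_(1 : R) (omega d)) hk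
  (isT : 0 < 6 <= 6)%N smooth_domega Uy.
by rewrite eq_sym (negbTE k3).
Qed.

Ltac der := repeat first
  [ eassumption | apply derive_fcst | apply derive_fD | apply derive_fN
  | apply derive_fM | apply derive_fX ].

Lemma partial_metric k i j x : (0 < k <= 6)%N -> (0 < i <= 6)%N ->
  (0 < j <= 6)%N -> U x ->
  partial (idx k) (fun y => g y (idx i) (idx j)) x =
  dgram (e3 d) (e6 d) (eps d) (epst d) (A d x) (At d x) (gap d x) (nil3 d x)
    (nil6 d x) (dtheta d x) (domega d x) k i j.
Proof.
move=> hk hi hj Ux; apply: partialE.
under eq_fun do rewrite h33_metricE// /gram /gram_table /gram_block.
rewrite -/(ax k).
have hA := derives_A hk Ux; have hB := derives_At hk Ux.
have hD := derives_gap hk Ux; have hu := derives_nil3 hk Ux.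
have hv := derives_nil6 hk Ux.
rewrite /dgram /dgram_table /dgram_block.
(* The derivatives along [k] become variables, so the case analysis runs over [i] and [j] only. *)
move: (grad_A _ _ _) (grad_B _ _ _) (grad_D _ _ _) (grad_u _ _) (grad_v _ _)
  hA hB hD hu hv => a b c p q hA hB hD hu hv.
move: i hi => [|[|[|[|[|[|[|//]]]]]]]// _;
by move: j hj => [|[|[|[|[|[|[|//]]]]]]]// _ /=;
  (eapply is_derive_eq; [by der|rewrite /=; ring]).
Qed.

Lemma christoffelE i j k x : (0 < i <= 6)%N -> (0 < j <= 6)%N ->
  (0 < k <= 6)%N -> U x ->
  christoffel g (idx i) (idx j) (idx k) x =
  gamma_table (eps d) (epst d) (e6 d / e3 d) (e3 d / e6 d) (A d x) (A d x)^-1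
    (At d x) (At d x)^-1 (gap d x)^-1 (nil3 d x) (nil6 d x) (dtheta d x)
    (domega d x) i j k.
Proof.
move=> hi hj hk Ux; have [c0 c'0] := h33_sign hU.
set tab := gamma_table _ _ _ _ _ _ _ _ _ _ _ _ _.
pose col : 'cV[R]_6 := \col_m tab m.+1 j k.
have colE m : (0 < m <= 6)%N -> col (idx m) ord0 = tab m j k.
  by move=> hm; rewrite mxE; case: m hm => // m hm; rewrite /= modn_small.
(* The candidate column is written as the inverse metric times its lowered form, which reduces the
   claim to [gram_gamma]. *)
rewrite -colE// -[in RHS](mulKmx (h33_unit hU Ux) col) [RHS]mxE.
rewrite /christoffel mulr_sumr; apply: eq_bigr => l _.
rewrite mulrCA; congr (_ * _); elim/ord6P: l => l hl.
rewrite !partial_metric// (gram_gamma _ _ _ _ _ _ c0 c'0 (A_neq0 hU Ux)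
  (At_neq0 hU Ux) (gap_neq0 hU Ux) hl hj hk).
rewrite mulrA mulVf ?pnatr_eq0// mul1r mxE sum_ord6 /sum6.
by rewrite !colE// !h33_metricE.
Qed.

End HSpaceConnection.

(** * The flat case *)

Section Flat.
Variables (R : realType) (d : h33_data R) (U : set 'rV[R]_6).
Hypotheses (hU : h33_space d U) (eps0 : eps d = 0) (epst0 : epst d = 0).
Local Notation g := (h33_metric d).

(** For eps = epst = 0 these are the logarithmic derivatives of theta and omega. *)
Definition flat_symbol (i : nat) (y : 'rV[R]_6) : R :=
  match i with
  | 3 => ((A d y)^-1 * dtheta d y)%R
  | 6 => ((At d y)^-1 * domega d y)%R
  | _ => 0%R
  end%N.

Lemma christoffel_flat i j k y : (0 < i <= 6)%N -> (0 < j <= 6)%N ->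
  (0 < k <= 6)%N -> U y -> christoffel g (idx i) (idx j) (idx k) y =
  if (i == j) && (j == k) then flat_symbol i y else 0.
Proof.
move=> hi hj hk Uy; rewrite (christoffelE hU)// eps0 epst0.
have -> : nil3 d y = 0 by rewrite /nil3 eps0 mul0r.
have -> : nil6 d y = 0 by rewrite /nil6 epst0 mul0r.
rewrite /gamma_table /gamma_block.
move: i hi => [|[|[|[|[|[|[|//]]]]]]]// _;
move: j hj => [|[|[|[|[|[|[|//]]]]]]]// _;
by move: k hk => [|[|[|[|[|[|[|//]]]]]]]// _ /=; ring.
Qed.

Lemma partial_flat_symbol k i y : (0 < k <= 6)%N -> k != i -> U y ->
  partial (idx k) (flat_symbol i) y = 0.
Proof.
move=> hk ki Uy; apply: partialE; rewrite -/(axis R (fun k => k) k).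
have hA := derives_A hU hk Uy; have hB := derives_At hU hk Uy.
have iA := derive_fV (A_neq0 hU Uy) hA.
have iB := derive_fV (At_neq0 hU Uy) hB.
rewrite /flat_symbol.
move: i ki => [|[|[|[|[|[|[|i]]]]]]] ki; try exact: derive_fcst.
- have ht := derive_dtheta hU hk ki Uy.
  eapply is_derive_eq; first exact: derive_fM iA ht.
  have -> : grad_A (eps d) (dtheta d y) k = 0.
    by move: k hk ki {hA hB iA iB ht} => [|[|[|[|]]]].
  by rewrite mul0r oppr0 !mulr0 addr0.
- have ht := derive_domega hU hk ki Uy.
  eapply is_derive_eq; first exact: derive_fM iB ht.
  have -> : grad_B (epst d) (domega d y) k = 0.
    by move: k hk ki {hA hB iA iB ht} => [|[|[|[|[|[|[|]]]]]]].
  by rewrite mul0r oppr0 !mulr0 addr0.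
Qed.

(** Only Gamma^3_33 and Gamma^6_66 survive, each a function of its own coordinate, so for k != l
    both the derivative and the quadratic terms vanish. *)
Lemma curvature_flat (i j k l : 'I_6) x : U x -> curvature g i j k l x = 0.
Proof.
move=> Ux; have [<-|kl] := eqVneq k l.
  by rewrite /curvature subrr add0r subrr.
elim/ord6P: i => i hi; elim/ord6P: j => j hj.
elim/ord6P: k kl => k hk; elim/ord6P: l => l hl; rewrite idx_eq// => kl.
have dE a b : (0 < a <= 6)%N -> (0 < b <= 6)%N -> a != b ->
    partial (idx a) (christoffel g (idx i) (idx b) (idx j)) x = 0.
  move=> ha hb ab.
  transitivity (partial (idx a) (fun y =>
      if (i == b) && (b == j) then flat_symbol i y else 0) x).
    apply: (partial_ext (h33_open hU)) => // y Uy.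
    by rewrite christoffel_flat.
  have [/andP[/eqP ib _]|_] := boolP ((i == b) && (b == j)); last first.
    by apply: partialE; exact: derive_fcst.
  by apply: partial_flat_symbol => //; rewrite ib.
have qE a b : (0 < a <= 6)%N -> (0 < b <= 6)%N -> a != b ->
    \sum_m christoffel g (idx i) (idx a) m x * christoffel g m (idx b) (idx j) x
      = 0.
  move=> ha hb ab; apply: big1 => m _; elim/ord6P: m => m hm.
  rewrite !christoffel_flat//.
  case: ifP => [/andP[_ /eqP am]|_]; last by rewrite mul0r.
  case: ifP => [/andP[/eqP mb _]|_]; last by rewrite mulr0.
  by move: ab; rewrite am mb eqxx.
have lk : l != k by rewrite eq_sym.
by rewrite /curvature !dE// !qE// !subr0 addr0.
Qed.

Lemma constant_curvature_flat : constant_curvature U g.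
Proof. by exists 0 => x Ux i j k l; rewrite curvature_flat// mul0r. Qed.

End Flat.

Section Swap.
Variable R : fieldType.

Lemma gamma_table_swap (E T e ie A iA B iB iD u v t w : R) i j k :
  (0 < i <= 6)%N -> (0 < j <= 6)%N -> (0 < k <= 6)%N ->
  gamma_table E T e ie A iA B iB iD u v t w (swap6 i) (swap6 j) (swap6 k) =
  gamma_table T E ie e B iB A iA (- iD) v u w t i j k.
Proof.
move: i => [|[|[|[|[|[|[|//]]]]]]]// _; move: j => [|[|[|[|[|[|[|//]]]]]]]// _;
by move: k => [|[|[|[|[|[|[|//]]]]]]]// _; rewrite /gamma_table /= opprK.
Qed.

Lemma ginv_table_swap (c c' iA iB iD u v : R) i j :
  (0 < i <= 6)%N -> (0 < j <= 6)%N ->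
  ginv_table c c' iA iB iD u v (swap6 i) (swap6 j) =
  ginv_table c' c iB iA (- iD) v u i j.
Proof.
move: i => [|[|[|[|[|[|[|//]]]]]]]// _;
by move: j => [|[|[|[|[|[|[|//]]]]]]]// _; rewrite /ginv_table /= opprK.
Qed.

End Swap.

(** * A linear functional that detects homotheties *)

Section Rigidity.
Variables (R : realType) (d : h33_data R) (U : set 'rV[R]_6).
Hypothesis hU : h33_space d U.
Local Notation g := (h33_metric d).
Local Notation G := (inv_metric d).

Lemma swap6_range k : (0 < k <= 6)%N -> (0 < swap6 k <= 6)%N.
Proof. by move: k => [|[|[|[|[|[|[|]]]]]]]. Qed.

Lemma swap6K k : (0 < k <= 6)%N -> swap6 (swap6 k) = k.
Proof. by move: k => [|[|[|[|[|[|[|]]]]]]]. Qed.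

Lemma inv_metricE i j y : (0 < i <= 6)%N -> (0 < j <= 6)%N ->
  G y (idx i) (idx j) = ginv_table (e3 d)^-1 (e6 d)^-1 (A d y)^-1 (At d y)^-1
    (gap d y)^-1 (nil3 d y) (nil6 d y) i j.
Proof.
have lab m : (0 < m <= 6)%N -> (val (idx m)).+1 = m.
  by case: m => // m hm; rewrite /= modn_small.
by move=> hi hj; rewrite mxE !lab.
Qed.

(* [q] reads off the coefficient of b along the nontrivial solution of the
   Eisenhart equation, up to a nonzero factor. *)
Definition detects_homothety (q : 'rV[R]_6 -> 'M[R]_6 -> R) : Prop :=
  (forall x a M N, q x (a *: M + N) = a * q x M + q x N) /\
  forall b phi, (forall y, (b y)^T = b y) -> smooth_mx U b ->
    smooth_on U phi ->
    (forall x, U x -> forall i j k : 'I_6,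
      cov_deriv g b i j k x = 2 * g x i j * partial k phi x
        + g x i k * partial j phi x + g x j k * partial i phi x) ->
    forall x0, U x0 -> q x0 (b x0) = 0 ->
      exists k, forall x, U x -> b x = k *: g x.

Lemma block_integral_linear nu D (c c' : R) (F : 'rV[R]_6 -> 'M[R]_6) x a M N :
  block_integral nu D c c' F (a *: M + N) x =
  a * block_integral nu D c c' F M x + block_integral nu D c c' F N x.
Proof.
rewrite /block_integral mulmxDr mulmxDl -scalemxAr -scalemxAl.
move: (F x *m M *m F x) (F x *m N *m F x) => P Q.
by rewrite !mxE; ring.
Qed.

Lemma detects_homothety_eps : eps d = 1 -> exists q, detects_homothety q.
Proof.
move=> eps1; have [c0 c'0] := h33_sign hU.
exists (fun x b => block_integral (fun k => k) (gap d) (e3 d) (e6 d) G b x).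
split=> [x a M N|b phi bT sb sphi eis x0]; first exact: block_integral_linear.
have dA := derives_A hU; have dB := derives_At hU.
have dD := @derives_gap R d U; have du := @derives_nil3 R d U.
have dv := @derives_nil6 R d U.
rewrite eps1 in dA dD du.
apply: (conformal_of_integral (h33_open hU) (h33_connected hU)
  (smooth_gap hU) c0 c'0 (A_neq0 hU) (At_neq0 hU) (gap_neq0 hU)
  dA dB dD du dv _ (h33_metric_sym d) (metric_inv hU) (smooth_h33_metric hU)
  (smooth_inv_metric hU) _ _ _ _ _ bT sb sphi eis).
- by move=> k y Uy [] ->; apply: derive_domega Uy.
- by move=> i j k y hi hj hk Uy; rewrite (christoffelE hU)// eps1 /gam invf_div.
- by move=> i j y hi hj _; rewrite inv_metricE.
- by move=> F; rewrite sum_ord6.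
- by elim/ord6P => k hk; exists k.
- by move=> i j hi hj; rewrite idx_eq.
Qed.

(** The same analysis with the blocks exchanged: the gap changes sign, [e3] and [e6] trade places,
    and [eps] plays the part of T. *)
Lemma detects_homothety_epst : epst d = 1 -> exists q, detects_homothety q.
Proof.
move=> epst1; have [c0 c'0] := h33_sign hU.
exists (fun x b => block_integral swap6 (fun y => - gap d y) (e6 d) (e3 d) G b x).
split=> [x a M N|b phi bT sb sphi eis x0]; first exact: block_integral_linear.
have dA : derives U (axis R swap6) (At d) (fun k y => grad_A 1 (domega d y) k).
  move=> k y hk Uy; have := derives_At hU (swap6_range hk) Uy.
  by rewrite epst1; move: k hk => [|[|[|[|[|[|[|//]]]]]]].
have dB : derives U (axis R swap6) (A d)
    (fun k y => grad_B (eps d) (dtheta d y) k).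
  move=> k y hk Uy; have := derives_A hU (swap6_range hk) Uy.
  by move: k hk => [|[|[|[|[|[|[|//]]]]]]].
have dD : derives U (axis R swap6) (fun y => - gap d y)
    (fun k y => grad_D 1 (eps d) k).
  move=> k y hk Uy.
  have := derive_fN (@derives_gap R d U _ _ (swap6_range hk) Uy).
  rewrite epst1.
  by move: k hk => [|[|[|[|[|[|[|//]]]]]]] _ /=; rewrite ?oppr0 ?opprK.
have du : derives U (axis R swap6) (nil6 d) (fun k y => grad_u 1 k).
  move=> k y hk Uy; have := @derives_nil6 R d U _ _ (swap6_range hk) Uy.
  by rewrite epst1; move: k hk => [|[|[|[|[|[|[|//]]]]]]].
have dv : derives U (axis R swap6) (nil3 d) (fun k y => grad_v (eps d) k).
  move=> k y hk Uy; have := @derives_nil3 R d U _ _ (swap6_range hk) Uy.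
  by move: k hk => [|[|[|[|[|[|[|//]]]]]]].
have gap0 y : U y -> - gap d y != 0 by rewrite oppr_eq0; exact: gap_neq0.
apply: (conformal_of_integral (h33_open hU) (h33_connected hU)
  (smoothN (h33_open hU) (smooth_gap hU)) c'0 c0 (At_neq0 hU) (A_neq0 hU) gap0
  dA dB dD du dv _ (h33_metric_sym d) (metric_inv hU) (smooth_h33_metric hU)
  (smooth_inv_metric hU) _ _ _ _ _ bT sb sphi eis).
- by move=> k y Uy [] ->; apply: (derive_dtheta hU) Uy.
- move=> i j k y hi hj hk Uy.
  rewrite (christoffelE hU) ?swap6_range// epst1 gamma_table_swap//.
  by rewrite /gam invf_div invrN.
- move=> i j y hi hj _; rewrite inv_metricE ?swap6_range//.
  by rewrite ginv_table_swap// invrN.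
- move=> F; rewrite sum_ord6 /sum6 /=; ring.
- by elim/ord6P => k hk; exists (swap6 k); rewrite ?swap6K ?swap6_range.
- move=> i j hi hj; rewrite idx_eq ?swap6_range//.
  by move: i hi => [|[|[|[|[|[|[|//]]]]]]]// _;
     move: j hj => [|[|[|[|[|[|[|//]]]]]]]// _.
Qed.

Lemma detects_homothety_exists : ~ constant_curvature U g ->
  exists q, detects_homothety q.
Proof.
move=> ncc; have [_ [[_ _ he het] _]] := hU.
case: he => [eps0|]; last exact: detects_homothety_eps.
case: het => [epst0|]; last exact: detects_homothety_epst.
by case: ncc; exact: constant_curvature_flat.
Qed.

End Rigidity.

(** * Linearity and locality of the Lie derivative *)

Section LieDerivativeLinear.
Variables (R : realType) (n : nat) (U : set 'rV[R]_n).
Hypothesis openU : open U.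
Local Notation vfield := ('rV[R]_n -> 'rV[R]_n).
Implicit Types (X Y : vfield) (g : 'rV[R]_n -> 'M[R]_n).

Lemma lie_deriv_sym X g y : (forall z, (g z)^T = g z) ->
  (lie_deriv X g y)^T = lie_deriv X g y.
Proof.
move=> gT; have gE i j : (fun z => g z i j) = (fun z => g z j i).
  by apply/funext => z; rewrite -{1}gT mxE.
apply/matrixP => i j; rewrite !mxE; apply: eq_bigr => l _.
rewrite (gE j i) -[g y l i](congr1 (fun f => f y) (gE i l)).
by rewrite -[g y j l](congr1 (fun f => f y) (gE l j)) addrAC.
Qed.

Lemma smooth_lie_deriv X g : smooth_vfield U X -> smooth_mx U g ->
  smooth_mx U (lie_deriv X g).
Proof.
move=> sX sg; have sJ := smooth_jacmx sX.
apply: (smooth_mx_ext openU) (_ : smooth_mx U (fun y =>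
  dirmx X g y + (jacmx X y)^T *m g y + g y *m jacmx X y)).
  by move=> y _; rewrite lie_derivE.
apply: smooth_mxD => //; last exact: smooth_mxM.
apply: smooth_mxD => //; first exact: smooth_dirmx.
by apply: smooth_mxM => //; exact: smooth_mx_tr.
Qed.

Lemma lie_deriv_linear c X Y g x : smooth_vfield U X -> smooth_vfield U Y ->
  U x -> lie_deriv (c *: X + Y) g x = c *: lie_deriv X g x + lie_deriv Y g x.
Proof.
move=> sX sY Ux; apply/matrixP => i j; rewrite !mxE mulr_sumr -big_split /=.
have dE k l : partial k (fun y => (c *: X + Y) y ord0 l) x =
    c * partial k (fun y => X y ord0 l) x + partial k (fun y => Y y ord0 l) x.
  under [X in partial _ X]eq_fun do rewrite !mxE.
  have := derive_fD (derive_fM (derive_fcst x (delta_mx ord0 k) c)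
    (smooth_partial k (sX l) Ux)) (smooth_partial k (sY l) Ux).
  by rewrite mulr0 addr0; exact: partialE.
by apply: eq_bigr => l _; rewrite !dE !mxE; ring.
Qed.

Lemma lie_deriv_ext X Y g x : (forall y, U y -> X y = Y y) -> U x ->
  lie_deriv X g x = lie_deriv Y g x.
Proof.
move=> XY Ux; apply/matrixP => i j; rewrite !mxE; apply: eq_bigr => l _.
rewrite XY//; have dE k : partial k (fun y => X y ord0 l) x =
    partial k (fun y => Y y ord0 l) x.
  by apply: (partial_ext openU) => // y Uy; rewrite XY.
by rewrite !dE.
Qed.

End LieDerivativeLinear.

Theorem theorem6 (R : realType) (d : h33_data R) (U : set 'rV[R]_6)
  (r : nat) (P : set ('rV[R]_6 -> 'rV[R]_6)) :
  h33_space d U ->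
  ~ constant_curvature U (h33_metric d) ->
  nonhomothetic_projective_algebra U (h33_metric d) r P ->
  exists H : set ('rV[R]_6 -> 'rV[R]_6),
    [/\ H `<=` P,
        lie_algebra_of_dim U r.-1 H &
        forall xi, H xi -> homothety U (h33_metric d) xi].
Proof.
move=> hU ncc [algP projP [xi0 Pxi0 nhom]].
have openU := h33_open hU; set g := h33_metric d in projP nhom *.
have sg : smooth_mx U g := smooth_h33_metric hU.
have gT := h33_metric_sym d.
have [x0 Ux0] : U !=set0 by have [[]] := hU.
have [q [qlin qhom]] := detects_homothety_exists hU ncc.
have smP xi : P xi -> smooth_vfield U xi by move=> /projP[].
(* One point suffices because the first integral is constant on the connected set [U]. *)
pose lam xi := q x0 (lie_deriv xi g x0).
have q0 : q x0 0 = 0.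
  have /eqP := qlin x0 1 0 0.
  by rewrite scaler0 addr0 mul1r -subr_eq subrr eq_sym => /eqP.
have lam_hom xi : P xi -> lam xi = 0 -> homothety U g xi.
  move=> Pxi lxi; have [sxi [phi sphi eis]] := projP _ Pxi.
  split => //; have [k hk] := qhom (lie_deriv xi g) phi
    (fun y => lie_deriv_sym xi y gT) (smooth_lie_deriv openU sxi sg) sphi eis
    x0 Ux0 lxi.
  by exists k.
exists [set xi | P xi /\ lam xi = 0]; split.
- by move=> xi [].
- apply: (lie_algebra_kernel _ _ _ algP Pxi0).
  + move=> c xi eta Pxi Peta; rewrite /lam.
    by rewrite (lie_deriv_linear c g (smP _ Pxi) (smP _ Peta) Ux0) qlin.
  + by move=> xi eta _ _ h; rewrite /lam (lie_deriv_ext openU g h Ux0).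
  + move=> xi eta Pxi Peta lxi leta.
    (* Both fields are homotheties, so their bracket is a Killing field and [lam] of it is
       [q x0 0]. *)
    have [sxi [c hc]] := lam_hom _ Pxi lxi.
    have [seta [c' hc']] := lam_hom _ Peta leta.
    by rewrite /lam (lie_deriv_bracket openU sg sxi seta hc hc' Ux0).
  + by apply/eqP => /(lam_hom _ Pxi0).
- by move=> xi [Pxi]; exact: lam_hom.
Qed.
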